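(* Let $X$ be a Banach space with norm $\|\cdot\|$, let $T>0$, $u_0\in X$, and let $p\geq 6$ be an integer. Suppose that $F\in C^{p}([0,T]\times X,X)$ is such that the Cauchy problem $$\frac{du}{dt}=F(t,u),\quad t\in[0,T],\qquad u(0)=u_0,$$ has a unique solution $u\in C^{p+1}([0,T],X)$. For a positive integer $N$, let $k=T/N$ and $t_n=nk$ for $n=0,1,\dots,N$, and let $\{u^{4,n}\}_{n=0}^N$ be the sequence of approximate solutions of this Cauchy problem produced by the classical fourth-order explicit Runge-Kutta method (RK4) on the partition $0=t_0<\cdots<t_N=T$ of $[0,T]$. Then $\{u^{4,n}\}_{n=0}^N$ satisfies the deferred correction condition for RK4: $$\left\| D_+^m\left(u^{4,n}-u(t_n)\right)\right\|\leq C k^4,\qquad m=0,1,2,\dots,p-4,\quad n=0,1,2,\dots,N-m,$$ where $C$ is a constant independent of $k$.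
   Context: Forward differences: for a sequence $\{v^n\}$ in $X$ on the grid $t_n=nk$, $D_+v^n=(v^{n+1}-v^n)/k$, $D_+^0v^n=v^n$, and for $m\ge 1$ $$D_+^m v^n=D_+\left(D_+^{m-1}v^n\right)=k^{-m}\sum_{i=0}^m(-1)^i\binom{m}{i}v^{n+m-i}.$$ In the claim, $D_+^m$ is applied to the sequence $v^n=u^{4,n}-u(t_n)$. Classical RK4 with step $k$: $u^{4,0}=u_0$ and, for $n=0,\dots,N-1$, $$u^{4,n+1}=u^{4,n}+\frac{k}{6}\left(K_1^n+2K_2^n+2K_3^n+K_4^n\right),$$ where $$K_1^n=F(t_n,u^{4,n}),\quad K_2^n=F\left(t_n+\tfrac{k}{2},u^{4,n}+\tfrac{k}{2}K_1^n\right),\quad K_3^n=F\left(t_n+\tfrac{k}{2},u^{4,n}+\tfrac{k}{2}K_2^n\right),\quad K_4^n=F\left(t_n+k,u^{4,n}+kK_3^n\right).$$ Deferred correction condition (DCC) for RK4: a sequence $\{u^{4,n}\}_{n=0}^N$ of approximations of $u$ at $t_0,\dots,t_N$ satisfies the DCC for RK4 if it approximates $u(t_n)$ with order 4 of accuracy and, for each integer $i=0,1,2,\dots$ and $n=0,1,\dots,N-i$, one has $\|D_+^i(u^{4,n}-u(t_n))\|\leq Ck^4$ provided $u$ is $C^{5+i}$, with $C$ independent of $k$. With $u\in C^{p+1}$, this is the range $i\le p-4$. The constant $C$ may depend on $T$, $p$, $F$, $u$, but not on $k$ (equivalently $N$) or $n$. *)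

(* Defs.v *)
From HB Require Import structures.
From mathcomp Require Import all_boot all_order all_algebra.
From mathcomp Require Import all_classical all_reals all_analysis.

Set Implicit Arguments.
Unset Strict Implicit.
Unset Printing Implicit Defensive.

Import Order.TTheory GRing.Theory Num.Theory.
Import numFieldNormedType.Exports.

Local Open Scope classical_set_scope.
Local Open Scope ring_scope.

(* An n-linear map is encoded as a function on [seq E] of which only the values
   on sequences of size n matter; the constraints below never mention others. *)
Definition bounded_multilinear (R : realType) (E V : normedModType R)
    (n : nat) (L : seq E -> V) : Prop :=
  (forall (s1 s2 : seq E) (a : R) (h h' : E), (size s1 + size s2).+1 = n ->
     L (s1 ++ (a *: h + h') :: s2) =
     a *: L (s1 ++ h :: s2) + L (s1 ++ h' :: s2)) /\
  (exists M : R, forall hs : seq E, size hs = n ->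
     `|L hs| <= M * \prod_(h <- hs) `|h|).

(* f is C^n on D in the sense of Frechet.  With L(E, L^j(E; V)) identified
   isometrically with L^{j+1}(E; V) as usual, [d x hs] is the derivative of
   order [size hs] of f at x, relative to D, applied to hs, and the head of hs
   is the direction of the last differentiation.  The bounds that are uniform
   in hs are those of the operator norm on L^j(E; V).
   For D = [0, T] x X, derivatives at the end points are thus one-sided in time;
   the values of f outside D play no role. *)
Definition Cn_on (R : realType) (E V : normedModType R)
    (D : set E) (n : nat) (f : E -> V) : Prop :=
  exists d : E -> seq E -> V,
  [/\ forall x, D x -> d x [::] = f x,
      forall x j, D x -> (j <= n)%N -> bounded_multilinear j (d x),
      forall x j, D x -> (j < n)%N -> forall e : R, 0 < e ->
        \forall y \near within D (nbhs x), forall hs : seq E, size hs = j ->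
          `|d y hs - d x hs - d x ((y - x) :: hs)|
            <= e * `|y - x| * \prod_(h <- hs) `|h|
    & forall x j, D x -> (j <= n)%N -> forall e : R, 0 < e ->
        \forall y \near within D (nbhs x), forall hs : seq E, size hs = j ->
          `|d y hs - d x hs| <= e * \prod_(h <- hs) `|h| ].

(* One-sided at t = 0 and t = T. *)
Definition has_deriv_on (R : realType) (X : normedModType R) (T : R)
    (u : R -> X) (t : R) (v : X) : Prop :=
  (s - t)^-1 *: (u s - u t) @[s --> within `[0, T] t^'] --> v.

Definition Cn_curve (R : realType) (X : normedModType R) (T : R) (n : nat)
    (u : R -> X) : Prop :=
  exists d : nat -> R -> X,
  [/\ {in `[0, T], d 0%N =1 u},
      forall j t, (j < n)%N -> t \in `[0, T] ->
        has_deriv_on T (d j) t (d j.+1 t)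
    & forall j, (j <= n)%N -> {within `[0, T], continuous (d j)} ].

Definition solves_cauchy (R : realType) (X : normedModType R) (T : R)
    (F : R * X -> X) (u0 : X) (u : R -> X) : Prop :=
  u 0 = u0 /\
  (forall t, t \in `[0, T] -> has_deriv_on T u t (F (t, u t))).

Definition unique_solution (R : realType) (X : normedModType R) (T : R)
    (F : R * X -> X) (u0 : X) (u : R -> X) : Prop :=
  solves_cauchy T F u0 u /\
  (forall w : R -> X, solves_cauchy T F u0 w -> {in `[0, T], w =1 u}).

Definition Dplus (R : realType) (X : normedModType R) (k : R)
    (v : nat -> X) : nat -> X :=
  fun n => k^-1 *: (v n.+1 - v n).

Definition Dplus_iter (R : realType) (X : normedModType R) (k : R) (m : nat)
    (v : nat -> X) : nat -> X :=
  iter m (Dplus k) v.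

Definition rk4_step (R : realType) (X : normedModType R)
    (F : R * X -> X) (k t : R) (x : X) : X :=
  let K1 := F (t, x) in
  let K2 := F (t + k / 2, x + (k / 2) *: K1) in
  let K3 := F (t + k / 2, x + (k / 2) *: K2) in
  let K4 := F (t + k, x + k *: K3) in
  x + (k / 6) *: (K1 + 2 *: K2 + 2 *: K3 + K4).

(* Total in n; with k = T / N only the terms n <= N are approximations on the
   grid, and these evaluate F on [0, T] x X only. *)
Fixpoint rk4 (R : realType) (X : normedModType R)
    (F : R * X -> X) (u0 : X) (k : R) (n : nat) : X :=
  if n is n'.+1 then rk4_step F k (n'%:R * k) (rk4 F u0 k n') else u0.

(* Main.v *)
Require Import Defs.
From HB Require Import structures.
From mathcomp Require Import all_boot all_order all_algebra.
From mathcomp Require Import all_classical all_reals all_analysis.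
From mathcomp Require Import ring lra zify.

Set Implicit Arguments.
Unset Strict Implicit.
Unset Printing Implicit Defensive.

Import Order.TTheory GRing.Theory Num.Theory.
Import numFieldNormedType.Exports.

Local Open Scope classical_set_scope.
Local Open Scope ring_scope.

(** The error [e] of the method satisfies
      Dplus e n = 1/6 (Phi (rk n) - Phi (u t_n)) + tau n
   where [Phi x = K1 + 2 K2 + 2 K3 + K4] is built from the stages started at
   [x], and [tau] is the truncation error. The idea is to work throughout with
   grid families that are of order [k ^ q] together with their forward
   differences up to some order [r] (diffO), and to show that everything that
   the equation is made of respects this notion:

   - A function with [r] bounded derivatives maps families with bounded
     differences to such families, and with one or two more derivatives its
     increments, and the remainders of its linearization, are of the order
     dictated by the increments of the argument (diffO_jet0, diffO_jet1,
     diffO_jet0B, diffO_linearize). This is a discrete chain rule. To compare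
     [f] along two sequences [z] and [w], let [z n + s (w n - z n)] move from
     one to the other; the [r]-th difference is a finite linear combination of
     values, so that it may be differentiated in [s], and the mean value
     inequality applies (lipschitz_leP). The case [w n = z n.+1], divided by the
     step, lowers the order of the difference by one and drives the induction
     (chain_leP).

   - The same argument shows that sampling a smooth curve gives a family with
     bounded differences, and that Taylor remainders keep their order under
     differences (diffO_curve, diffO_taylor).

   Hence the classical verification that the method has order four can be made
   inside this calculus: expanding the stages around the slopes of the solution
   gives [tau] of order [k ^ 4] together with its differences up to order
   [p - 5] (truncationO). A discrete Gronwall argument gives the case without
   differences, [e = O (k ^ 4)], and shows that the numerical solution stays in
   a tube around the solution on which all derivatives of [F] are bounded
   (rk4_error). Then [e] gains one difference at a time: if its differences up
   to order [r] are [O (k ^ 4)], so are those of the right-hand side of the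
   error equation, that is, those of [e] up to order [r + 1] (Dplus_errorO).
   There remain finitely many coarse grids, which only affect the constant. *)

(** * Forward differences *)

Section Differences.
Context {R : realType} {X : normedModType R}.
Implicit Types (k : R) (v w : nat -> X) (r m n : nat).

Lemma Dplus_iterSr k r v : Dplus_iter k r.+1 v = Dplus_iter k r (Dplus k v).
Proof. by rewrite /Dplus_iter iterSr. Qed.

Lemma eq_Dplus_iter k r v w n :
  (forall i, (i <= r)%N -> v (n + i)%N = w (n + i)%N) ->
  Dplus_iter k r v n = Dplus_iter k r w n.
Proof.
elim: r v w => [|r IH] v w vw; first by have := vw 0%N isT; rewrite addn0.
rewrite !Dplus_iterSr; apply: IH => i ir.
by rewrite /Dplus -addnS !vw // ltnW.
Qed.

Lemma Dplus_iterP k r v w a n :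
  Dplus_iter k r (fun i => a *: v i + w i) n =
  a *: Dplus_iter k r v n + Dplus_iter k r w n.
Proof.
elim: r v w => [//|r IH] v w; rewrite !Dplus_iterSr -IH.
apply: eq_Dplus_iter => i _; rewrite /Dplus.
by rewrite opprD addrACA -scalerBr scalerDr scalerA mulrC -scalerA.
Qed.

Lemma Dplus_iter_shift k r v m n :
  Dplus_iter k r (fun i => v (i + m)%N) n = Dplus_iter k r v (n + m)%N.
Proof.
by elim: r v => [//|r IH] v; rewrite !Dplus_iterSr -IH.
Qed.

Lemma Dplus_iter0 k r n : Dplus_iter k r (fun=> 0 : X) n = 0.
Proof.
elim: r => [//|r IH]; rewrite Dplus_iterSr -{2}IH.
by apply: eq_Dplus_iter => i _; rewrite /Dplus subrr scaler0.
Qed.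

Lemma Dplus_iterZ k r v a n :
  Dplus_iter k r (fun i => a *: v i) n = a *: Dplus_iter k r v n.
Proof.
rewrite -[RHS]addr0 -(Dplus_iter0 k r n) -Dplus_iterP.
by apply: eq_Dplus_iter => i _; rewrite addr0.
Qed.

Lemma Dplus_iterD k r v w n :
  Dplus_iter k r (fun i => v i + w i) n = Dplus_iter k r v n + Dplus_iter k r w n.
Proof.
rewrite -[Dplus_iter k r v n]scale1r -Dplus_iterP.
by apply: eq_Dplus_iter => i _; rewrite scale1r.
Qed.

Lemma Dplus_iterB k r v w n :
  Dplus_iter k r (fun i => v i - w i) n = Dplus_iter k r v n - Dplus_iter k r w n.
Proof.
rewrite addrC -[- Dplus_iter k r w n]scaleN1r -Dplus_iterP.
by apply: eq_Dplus_iter => i _; rewrite scaleN1r addrC.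
Qed.

End Differences.

(** * The mean value inequality *)

(** The derivative of a curve relative to the segment [[a, b]], in the form that
   the mean value inequality consumes. *)
Definition deriv_within (R : realType) (X : normedModType R) (a b : R)
    (f : R -> X) (s : R) (v : X) :=
  forall e, 0 < e -> \forall s' \near s, a <= s' <= b ->
    `|f s' - f s - (s' - s) *: v| <= e * `|s' - s|.

Section DerivWithin.
Context {R : realType} {X : normedModType R} (a b : R).
Implicit Types (f g : R -> X).

Lemma deriv_withinP f g s v w c :
  deriv_within a b f s v -> deriv_within a b g s w ->
  deriv_within a b (fun s => c *: f s + g s) s (c *: v + w).
Proof.
move=> df dg e e0.
have e1 : 0 < e / 2 / (`|c| + 1) by rewrite !divr_gt0 // ltr_wpDl.
have e2 : 0 < e / 2 by rewrite divr_gt0.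
have := df _ e1; have := dg _ e2; apply: filterS2 => s' Hg Hf ab.
have -> : c *: f s' + g s' - (c *: f s + g s) - (s' - s) *: (c *: v + w) =
  c *: (f s' - f s - (s' - s) *: v) + (g s' - g s - (s' - s) *: w).
  rewrite scalerDr 2!scalerBr !scalerA [c * _]mulrC !opprD.
  by rewrite [RHS]addrACA; congr (_ + _); rewrite addrACA.
apply: le_trans (ler_normD _ _) _; rewrite normrZ.
have -> : e * `|s' - s| = e / 2 * `|s' - s| + e / 2 * `|s' - s|.
  by rewrite -mulrDl -splitr.
apply: lerD; last exact: Hg.
apply: le_trans (ler_wpM2l _ (Hf ab)) _ => //.
rewrite mulrA ler_wpM2r //.
by rewrite mulrCA ger_pMr // ler_pdivrMr ?mul1r ?lerDl // ltr_wpDl.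
Qed.

Lemma deriv_within_cst c s : deriv_within a b (fun=> c : X) s 0.
Proof.
by move=> e e0; near=> s' => _; rewrite subrr scaler0 subrr normr0 mulr_ge0 // ltW.
Unshelve. all: by end_near. Qed.

Lemma deriv_withinZ f s v c :
  deriv_within a b f s v -> deriv_within a b (fun s => c *: f s) s (c *: v).
Proof.
move=> df; have := deriv_withinP c df (deriv_within_cst 0 s).
rewrite addr0; congr (deriv_within _ _ _ _ _).
by apply/funext => t; rewrite addr0.
Qed.

Lemma deriv_withinD f g s v w :
  deriv_within a b f s v -> deriv_within a b g s w ->
  deriv_within a b (fun s => f s + g s) s (v + w).
Proof.
move=> df dg; have := deriv_withinP 1 df dg; rewrite scale1r.
by congr (deriv_within _ _ _ _ _); apply/funext => t; rewrite scale1r.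
Qed.

Lemma deriv_withinB f g s v w :
  deriv_within a b f s v -> deriv_within a b g s w ->
  deriv_within a b (fun s => f s - g s) s (v - w).
Proof.
move=> df dg; have := deriv_withinP (- 1) dg df; rewrite scaleN1r addrC.
by congr (deriv_within _ _ _ _ _); apply/funext => t; rewrite scaleN1r addrC.
Qed.

(** Differences are finite linear combinations, hence commute with a derivative
   in a parameter on which the whole sequence depends. *)
Lemma deriv_within_Dplus_iter k r (f : R -> nat -> X) (v : nat -> X) s n :
  (forall i, (i <= r)%N ->
     deriv_within a b (fun s => f s (n + i)%N) s (v (n + i)%N)) ->
  deriv_within a b (fun s => Dplus_iter k r (f s) n) s (Dplus_iter k r v n).
Proof.
elim: r f v => [|r IH] f v df; first by have := df 0%N isT; rewrite addn0.
rewrite Dplus_iterSr.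
under eq_fun do rewrite Dplus_iterSr.
apply: (IH (fun s => Dplus k (f s))) => i ir.
rewrite /Dplus -addnS; apply: deriv_withinZ.
by apply: deriv_withinB; apply: df => //; exact: ltnW.
Qed.

(** For each [e > 0], consider the supremum of the times up to which
   [`|f s - f a|] is at most [(M + e) * (s - a)]: differentiability there would
   carry the bound further if it were less than [b]. *)
Lemma mean_value_le f (g : R -> X) M :
  a <= b -> (forall s, a <= s <= b -> deriv_within a b f s (g s)) ->
  (forall s, a <= s <= b -> `|g s| <= M) ->
  `|f b - f a| <= M * (b - a).
Proof.
move=> ab df gM.
suff H e (e0 : 0 < e) : `|f b - f a| <= (M + e) * (b - a).
  rewrite leNgt; apply/negP => lt.
  have [eq|neq] := eqVneq a b; first by move: lt; rewrite eq !subrr normr0 mulr0 ltxx.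
  have ba : 0 < b - a by rewrite subr_gt0 lt_neqAle neq.
  have := H ((`|f b - f a| / (b - a) - M) / 2).
  rewrite divr_gt0 ?subr_gt0 ?ltr_pdivlMr // => /(_ isT).
  rewrite -ler_pdivrMr //.
  by move: lt; rewrite -ltr_pdivlMr //; lra.
pose Q s := `|f s - f a| <= (M + e) * (s - a).
pose S := [set s | a <= s <= b /\ forall s', a <= s' <= s -> Q s'].
have Sa : S a.
  split; first by rewrite lexx.
  by move=> s' /le_anti <-; rewrite /Q !subrr normr0 mulr0.
have Sb : ubound S b by move=> s [/andP[]].
have supS : has_sup S by split; [exists a | exists b].
set c := sup S.
have ac : a <= c by apply: ub_le_sup => //; exists b.
have cb : c <= b by apply: ge_sup => //; exists a.
have cab : a <= c <= b by rewrite ac cb.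
have step s' : a <= s' <= b ->
    `|f s' - f c - (s' - c) *: g c| <= e * `|s' - c| ->
    `|f s' - f c| <= (M + e) * `|s' - c|.
  move=> s'ab H; rewrite -[f s' - f c](subrK ((s' - c) *: g c)).
  apply: le_trans (ler_normD _ _) _; rewrite mulrDl addrC.
  apply: lerD => //; rewrite normrZ mulrC ler_wpM2r //; exact: gM.
have [d d0 Hd] : exists2 d, 0 < d & forall s', `|s' - c| < d -> a <= s' <= b ->
    `|f s' - f c| <= (M + e) * `|s' - c|.
  have /nbhs_ballP[d d0 Hd] := df _ cab _ e0.
  exists d => // s' s'd s'ab; apply: step => //; apply: Hd => //.
  by rewrite /ball /= distrC.
have Qc : Q c.
  have [s [sab Ss] cs] := sup_adherent d0 supS.
  have sc : s <= c by apply: ub_le_sup; [exists b|split].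
  rewrite /Q -[f c - f a](subrKA (f s)).
  have -> : c - a = (c - s) + (s - a) by rewrite subrKA.
  rewrite mulrDr; apply: le_trans (ler_normD _ _) _; apply: lerD.
    rewrite distrC -(ger0_norm (_ : 0 <= c - s)) ?subr_ge0 // (distrC c s).
    by apply: Hd => //; rewrite distrC ger0_norm ?subr_ge0 // ltrBlDl -ltrBlDr.
  by apply: Ss; rewrite lexx andbT; case/andP: sab.
have Qall s : a <= s <= b -> s < c + d -> Q s.
  move=> sab scd; case: (ltP s c) => [sc|cs].
    have cs0 : 0 < c - s by rewrite subr_gt0.
    have [s' [s'ab Ss'] cs'] := sup_adherent cs0 supS.
    apply: Ss'; case/andP: sab => -> _ /=.
    by move: cs'; rewrite -/c opprB addrC subrK => /ltW.
  rewrite /Q -[f s - f a](subrKA (f c)).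
  have -> : s - a = (s - c) + (c - a) by rewrite subrKA.
  rewrite mulrDr; apply: le_trans (ler_normD _ _) _; apply: lerD => //.
  rewrite -(ger0_norm (_ : 0 <= s - c)) ?subr_ge0 //.
  by apply: Hd => //; rewrite ger0_norm ?subr_ge0 // ltrBlDl.
apply: (Qall b); first by rewrite ab lexx.
rewrite ltNge; apply/negP => cdb.
have : S (c + d / 2).
  have d2 : c + d / 2 < c + d by move: d0; lra.
  split; first by move: d0 ac cdb; lra.
  move=> s' /andP[as' s'c]; apply: Qall; last exact: le_lt_trans d2.
  by rewrite as' /=; apply: le_trans s'c _; move: d2 cdb; lra.
move=> /(ub_le_sup (ex_intro _ b Sb)); rewrite -/c.
by move: d0; lra.
Unshelve. all: by end_near. Qed.

End DerivWithin.

(** * Differences of smooth functions along sequences *)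

(** The bound for the [r]-th differences of the [j]-th derivative of a function
   with derivatives bounded by [M], along sequences whose differences are
   bounded by [C]. The successor case mirrors the product rule: either the base
   point moves, which spends one more derivative in a direction of size [C], or
   one of the [j] directions does. *)
Fixpoint chain_bound (R : realType) (M C : R) (r j : nat) : R :=
  if r is r'.+1 then chain_bound M C r' j.+1 + j%:R * chain_bound M C r' j
  else M * C ^+ j.

Definition segment (R : realType) (E : normedModType R) (x y : E) (s : R) : E :=
  x + s *: (y - x).

Lemma segmentE (R : realType) (E : normedModType R) (x y : E) (s : R) :
  segment x y s = (1 - s) *: x + s *: y.
Proof. by rewrite /segment scalerBr scalerBl scale1r addrCA addrC. Qed.

Section SmoothAlongSequences.
Context {R : realType} {E V : normedModType R}.
Context (d : E -> seq E -> V) (p : nat) (K : set E) (M : R).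

(** [d x hs] is the derivative of order [size hs] at [x] in the directions [hs].
   The set [K] is convex because sequences in it are joined by segments, along
   which the bounds have to hold. *)
Definition bounded_jet :=
  [/\ forall x y s, K x -> K y -> 0 <= s <= 1 -> K (segment x y s),
      forall x j, K x -> (j <= p)%N -> bounded_multilinear j (d x),
      forall x j, K x -> (j < p)%N -> forall e : R, 0 < e ->
        \forall y \near within K (nbhs x), forall hs : seq E, size hs = j ->
          `|d y hs - d x hs - d x ((y - x) :: hs)|
            <= e * `|y - x| * \prod_(h <- hs) `|h|
    & forall x hs, K x -> (size hs <= p)%N ->
        `|d x hs| <= M * \prod_(h <- hs) `|h| ].

Hypothesis dK : bounded_jet.

Lemma jetP x hs1 hs2 a h h' : K x -> (size hs1 + size hs2 < p)%N ->
  d x (hs1 ++ (a *: h + h') :: hs2) =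
  a *: d x (hs1 ++ h :: hs2) + d x (hs1 ++ h' :: hs2).
Proof. by case: dK => _ Hl _ _ Kx sp; apply: (proj1 (Hl x _ Kx sp)). Qed.

Lemma jet0 x hs1 hs2 : K x -> (size hs1 + size hs2 < p)%N ->
  d x (hs1 ++ 0 :: hs2) = 0.
Proof.
move=> Kx sp; apply: (@addrI _ (d x (hs1 ++ 0 :: hs2))).
by rewrite -{1}[d x _]scale1r -jetP // scaler0 !addr0.
Qed.

Lemma jetZ x hs1 hs2 a h : K x -> (size hs1 + size hs2 < p)%N ->
  d x (hs1 ++ (a *: h) :: hs2) = a *: d x (hs1 ++ h :: hs2).
Proof. by move=> Kx sp; rewrite -[a *: h]addr0 jetP // jet0 // addr0. Qed.

Lemma jetB x hs1 hs2 h h' : K x -> (size hs1 + size hs2 < p)%N ->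
  d x (hs1 ++ (h - h') :: hs2) = d x (hs1 ++ h :: hs2) - d x (hs1 ++ h' :: hs2).
Proof.
by move=> Kx sp; rewrite addrC -scaleN1r jetP // scaleN1r addrC.
Qed.

Lemma deriv_within_jet x y hs s : K x -> K y -> (size hs < p)%N -> 0 <= s <= 1 ->
  deriv_within 0 1 (fun s => d (segment x y s) hs) s
    (d (segment x y s) ((y - x) :: hs)).
Proof.
move=> Kx Ky sp s01 e e0; have [Kc _ Kd _] := dK.
have Ks := Kc _ _ _ Kx Ky s01.
set P := \prod_(h <- hs) `|h|.
have P0 : 0 <= P by apply: prodr_ge0.
have e1 : 0 < e / ((`|y - x| + 1) * (P + 1)).
  by rewrite divr_gt0 // mulr_gt0 // ltr_wpDl.
have cvs : segment x y s' @[s' --> s] --> segment x y s.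
  apply: cvgD; first exact: cvg_cst.
  by apply: cvgZr_tmp; exact: cvg_id.
have near_s := cvs _ (Kd _ _ Ks sp _ e1).
apply: (@filterS _ (nbhs s) _ _ _ _ near_s) => s' /= H s'01.
have {H} := H (Kc _ _ _ Kx Ky s'01) hs erefl.
have -> : segment x y s' - segment x y s = (s' - s) *: (y - x).
  by rewrite /segment [x + s' *: _]addrC addrKA scalerBl.
rewrite (jetZ (hs1 := [::])) //= => H; apply: le_trans H _.
rewrite normrZ -/P.
have -> : e / ((`|y - x| + 1) * (P + 1)) * (`|s' - s| * `|y - x|) * P =
  e * `|s' - s| * ((`|y - x| * P) / ((`|y - x| + 1) * (P + 1))) by ring.
rewrite ler_piMr ?mulr_ge0 ?(ltW e0) // ler_pdivrMr ?mulr_gt0 ?ltr_wpDl //.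
by rewrite mul1r ler_pM // lerDl.
Qed.

Local Notation at_ n hs := [seq h n | h : nat -> E <- hs].

Definition diffs_le (W : normedModType R) (k C : R) (lo hi : nat) (z : nat -> W) :=
  forall i n, (lo <= i)%N -> (n + i <= hi)%N -> `|Dplus_iter k i z n| <= C.

Lemma diffs_le_Dplus (W : normedModType R) k C hi (z : nat -> W) :
  diffs_le k C 1 hi.+1 z -> diffs_le k C 0 hi (Dplus k z).
Proof. by move=> H i n _ ni; rewrite -Dplus_iterSr; apply: H; rewrite // addnS. Qed.

Lemma diffs_le_shift (W : normedModType R) k C lo hi (z : nat -> W) :
  diffs_le k C lo hi.+1 z -> diffs_le k C lo hi (fun n => z n.+1).
Proof.
move=> H i n lo_i ni.
have -> : Dplus_iter k i (fun n => z n.+1) n = Dplus_iter k i z n.+1.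
  by rewrite -addn1 -Dplus_iter_shift; apply: eq_Dplus_iter => m _; rewrite addn1.
exact: H.
Qed.

Lemma diffs_leW (W : normedModType R) k C lo hi lo' hi' (z : nat -> W) :
  (lo <= lo')%N -> (hi' <= hi)%N ->
  diffs_le k C lo hi z -> diffs_le k C lo' hi' z.
Proof.
move=> lo_lo hi_hi H i n lo_i ni; apply: H; first exact: leq_trans lo_i.
exact: leq_trans hi_hi.
Qed.

Lemma diffs_le_segment (W : normedModType R) k C lo hi (z w : nat -> W) s :
  0 <= s <= 1 -> diffs_le k C lo hi z -> diffs_le k C lo hi w ->
  diffs_le k C lo hi (fun n => segment (z n) (w n) s).
Proof.
move=> /andP[s0 s1] Hz Hw i n lo_i ni.
have -> : Dplus_iter k i (fun n => segment (z n) (w n) s) n =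
   (1 - s) *: Dplus_iter k i z n + s *: Dplus_iter k i w n.
  rewrite -(Dplus_iterZ _ _ z) [RHS]addrC -Dplus_iterP.
  apply: eq_Dplus_iter => m _.
  by rewrite segmentE addrC.
apply: le_trans (ler_normD _ _) _; rewrite !normrZ !ger0_norm ?subr_ge0 //.
have -> : C = (1 - s) * C + s * C by ring.
by rewrite lerD // ler_wpM2l ?subr_ge0 // ?Hz ?Hw.
Qed.

Section Bounds.
Context (k C : R).
Hypotheses (k0 : 0 < k) (C0 : 0 <= C) (M0 : 0 <= M).

Let chain_le r := forall z (hs : seq (nat -> E)),
  (size hs + r <= p)%N -> (forall n, (n <= r)%N -> K (z n)) ->
  diffs_le k C 1 r z -> {in hs, forall h, diffs_le k C 0 r h} ->
  `|Dplus_iter k r (fun n => d (z n) (at_ n hs)) 0| <= chain_bound M C r (size hs).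

Let lipschitz_le r := forall z w (delta : nat -> E) a (hs : seq (nat -> E)),
  (size hs + r < p)%N -> 0 <= a ->
  (forall n, (n <= r)%N -> K (z n) /\ K (w n)) ->
  (forall n, (n <= r)%N -> w n - z n = a *: delta n) ->
  diffs_le k C 1 r z -> diffs_le k C 1 r w -> diffs_le k C 0 r delta ->
  {in hs, forall h, diffs_le k C 0 r h} ->
  `|Dplus_iter k r (fun n => d (w n) (at_ n hs) - d (z n) (at_ n hs)) 0|
     <= a * chain_bound M C r (size hs).+1.

(** Moving along the segments from [z n] to [w n] simultaneously turns a
   difference of values into a derivative. *)
Let lipschitz_of_chain r : chain_le r -> lipschitz_le r.
Proof.
move=> chain z w delta a hs sp a0 Kzw wz Hz Hw Hdelta Hhs.
have [Kc _ _ _] := dK.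
pose f s := Dplus_iter k r (fun n => d (segment (z n) (w n) s) (at_ n hs)) 0.
have -> : Dplus_iter k r (fun n => d (w n) (at_ n hs) - d (z n) (at_ n hs)) 0 =
    f 1 - f 0.
  rewrite /f -Dplus_iterB; apply: eq_Dplus_iter => n _.
  by rewrite /segment scale1r scale0r addr0 [z n + (_ - _)]addrC subrK.
rewrite -[leRHS]mulr1 -{2}(subr0 1).
pose g s := Dplus_iter k r
  (fun n => d (segment (z n) (w n) s) ((w n - z n) :: at_ n hs)) 0.
apply: (mean_value_le (g := g)) => // s s01.
  apply: (deriv_within_Dplus_iter k
    (f := fun s n => d (segment (z n) (w n) s) (at_ n hs))) => n nr.
  have [Kz Kw] := Kzw _ nr.
  apply: deriv_within_jet => //; rewrite size_map.
  by apply: leq_ltn_trans sp; rewrite leq_addr.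
have -> : g s = a *: Dplus_iter k r
    (fun n => d (segment (z n) (w n) s) (at_ n (delta :: hs))) 0.
  rewrite -Dplus_iterZ; apply: eq_Dplus_iter => n nr /=.
  have [Kz Kw] := Kzw _ nr.
  rewrite wz // (jetZ (hs1 := [::])) //; first exact: Kc.
  by rewrite size_map; apply: leq_ltn_trans sp; rewrite leq_addr.
rewrite normrZ ger0_norm // ler_wpM2l //; apply: chain => //=.
- by move=> n nr; have [Kz Kw] := Kzw _ nr; exact: Kc.
- exact: diffs_le_segment.
- by move=> h; rewrite inE => /predU1P[->//|/Hhs].
Qed.

(** The product rule: the directions are moved by one step in time one after the
   other. Those in [hs1] stay at time [n]; the induction transfers the head of
   [hs2] to them. *)
Let move_directions r z (hs1 hs2 : seq (nat -> E)) : chain_le r ->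
  (size hs1 + size hs2 + r <= p)%N ->
  (forall n, (n <= r)%N -> K (z n)) -> diffs_le k C 1 r z ->
  {in hs1, forall h, diffs_le k C 0 r.+1 h} ->
  {in hs2, forall h, diffs_le k C 0 r.+1 h} ->
  `|Dplus_iter k r (fun n => k^-1 *: (d (z n) (at_ n hs1 ++ at_ n.+1 hs2)
      - d (z n) (at_ n (hs1 ++ hs2)))) 0|
     <= (size hs2)%:R * chain_bound M C r (size hs1 + size hs2).
Proof.
move=> chain; elim: hs2 hs1 => [|h hs2 IH] hs1 sp Kz Hz Hhs1 Hhs2.
  rewrite mul0r (eq_Dplus_iter k (w := fun=> 0)) ?Dplus_iter0 ?normr0 // => n _.
  by rewrite map_cat /= subrr scaler0.
rewrite (eq_Dplus_iter k (w := fun n =>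
  d (z n) (at_ n (hs1 ++ Dplus k h :: [seq (fun n => h n.+1) | h : nat -> E <- hs2]))
  + k^-1 *: (d (z n) (at_ n (rcons hs1 h) ++ at_ n.+1 hs2)
      - d (z n) (at_ n (rcons hs1 h ++ hs2))))); last first.
  move=> n nr; rewrite add0n !map_cat /=.
  have -> : at_ n [seq (fun n => h n.+1) | h : nat -> E <- hs2] = at_ n.+1 hs2.
    by rewrite -map_comp.
  have sp' : (size (at_ n hs1) + size (at_ n.+1 hs2) < p)%N.
    rewrite !size_map; apply: leq_trans sp => /=; lia.
  rewrite jetZ //; last exact: Kz.
  rewrite jetB //; last exact: Kz.
  rewrite -scalerDr !map_rcons !cat_rcons.
  by rewrite [X in _ = _ *: X]subrKA.
rewrite Dplus_iterD; apply: le_trans (ler_normD _ _) _.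
rewrite /= -natr1 mulrDl mul1r addrC.
have szE : (size hs1 + (size hs2).+1 = size (rcons hs1 h) + size hs2)%N.
  by rewrite size_rcons addSnnS.
have Hh1 : {in rcons hs1 h, forall h, diffs_le k C 0 r.+1 h}.
  move=> h' ; rewrite mem_rcons inE => /predU1P[->|/Hhs1//].
  by apply: Hhs2; rewrite mem_head.
have Hh2 : {in hs2, forall h, diffs_le k C 0 r.+1 h}.
  by move=> h' hh'; apply: Hhs2; rewrite inE hh' orbT.
apply: lerD; first by rewrite szE; apply: IH => //; rewrite -szE.
have -> : (size hs1 + (size hs2).+1)%N =
   size (hs1 ++ Dplus k h :: [seq (fun n => h n.+1) | h : nat -> E <- hs2]).
  by rewrite size_cat /= size_map.
apply: chain => //; first by rewrite size_cat /= size_map.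
move=> h'; rewrite mem_cat inE => /or3P[/Hhs1|/eqP->|/mapP[h2 /Hh2 Hh2' ->]].
- exact: diffs_leW.
- by apply: diffs_le_Dplus; apply: diffs_leW (Hhs2 _ (mem_head _ _)).
- exact: diffs_le_shift.
Qed.

Let chain_step r : chain_le r -> chain_le r.+1.
Proof.
move=> chain z hs sp Kz Hz Hhs; rewrite Dplus_iterSr [leRHS]/=.
pose shs := [seq (fun n => h n.+1) | h : nat -> E <- hs].
have shsE n : at_ n.+1 hs = at_ n shs by rewrite -map_comp.
rewrite (eq_Dplus_iter k (w := fun n =>
   k^-1 *: (d (z n.+1) (at_ n shs) - d (z n) (at_ n shs))
   + k^-1 *: (d (z n) (at_ n.+1 hs) - d (z n) (at_ n hs)))); last first.
  by move=> n _; rewrite /Dplus add0n shsE -scalerDr subrKA.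
rewrite Dplus_iterD; apply: le_trans (ler_normD _ _) _; apply: lerD; last first.
  apply: (move_directions (hs1 := [::])) => //.
  - by apply: leq_trans sp; rewrite leq_add2l.
  - by move=> n nr; apply: Kz; rewrite ltnW.
  - exact: diffs_leW Hz.
rewrite Dplus_iterZ normrZ gtr0_norm ?invr_gt0 // ler_pdivrMl //.
have <- : size shs = size hs by rewrite size_map.
apply: (lipschitz_of_chain chain (delta := Dplus k z)).
- by rewrite size_map -addnS.
- exact: ltW.
- by move=> n nr; split; apply: Kz; rewrite // ltnW.
- by move=> n _; rewrite /Dplus scalerA divff ?gt_eqF // scale1r.
- exact: diffs_leW Hz.
- exact: diffs_le_shift.
- exact: diffs_le_Dplus.
- by move=> _ /mapP[h /Hhs Hh ->]; exact: diffs_le_shift.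
Qed.

(** By induction on [r]: the first difference splits into the increment due to
   the base point, which is the Lipschitz estimate between [z] and its shift,
   and those due to the directions, which are again of the same form. *)
Lemma chain_leP r : chain_le r.
Proof.
elim: r => [|r IH]; last exact: chain_step.
move=> z hs sp Kz _ Hhs /=; have [_ _ _ Kb] := dK.
apply: le_trans (Kb _ _ _ _) _; first exact: Kz.
  by rewrite size_map -(addn0 (size _)).
rewrite ler_wpM2l // big_map.
elim: hs Hhs {sp} => [|h hs IH] Hhs; first by rewrite big_nil.
rewrite big_cons exprS ler_pM ?prodr_ge0 //.
  by apply: (Hhs h _ 0%N 0%N); rewrite ?mem_head.
by apply: IH => h' hh'; apply: Hhs; rewrite inE hh' orbT.
Qed.

Lemma lipschitz_leP r : lipschitz_le r.
Proof. exact: lipschitz_of_chain (@chain_leP r). Qed.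

(** The same path of segments, applied to the remainder of the linearization,
   gains a second factor [a]. *)
Lemma linearize_le r z w (delta : nat -> E) a :
  (1 + r < p)%N -> 0 <= a ->
  (forall n, (n <= r)%N -> K (z n) /\ K (w n)) ->
  (forall n, (n <= r)%N -> w n - z n = a *: delta n) ->
  diffs_le k C 1 r z -> diffs_le k C 1 r w -> diffs_le k C 0 r delta ->
  `|Dplus_iter k r (fun n => d (w n) [::] - d (z n) [::] - d (z n) [:: w n - z n]) 0|
     <= a ^+ 2 * chain_bound M C r 2.
Proof.
move=> sp a0 Kzw wz Hz Hw Hdelta; have [Kc _ _ _] := dK.
have p0 : (0 < p)%N by exact: leq_ltn_trans sp.
pose f s := Dplus_iter k r
  (fun n => d (segment (z n) (w n) s) [::] - s *: d (z n) [:: w n - z n]) 0.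
pose g s := Dplus_iter k r (fun n =>
  d (segment (z n) (w n) s) [:: w n - z n] - d (z n) [:: w n - z n]) 0.
have -> : Dplus_iter k r
    (fun n => d (w n) [::] - d (z n) [::] - d (z n) [:: w n - z n]) 0 = f 1 - f 0.
  rewrite /f -Dplus_iterB; apply: eq_Dplus_iter => n _.
  by rewrite /segment !scale0r !scale1r addr0 subr0 [z n + (_ - _)]addrC subrK addrAC.
rewrite -[leRHS]mulr1 -{2}(subr0 1).
apply: (mean_value_le (g := g)) => // s s01.
  apply: (deriv_within_Dplus_iter k (f := fun s n =>
     d (segment (z n) (w n) s) [::] - s *: d (z n) [:: w n - z n])) => n nr.
  have [Kz Kw] := Kzw _ nr; apply: deriv_withinB; first exact: deriv_within_jet.
  move=> e e0; near=> s' => _.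
  by rewrite -scalerBl subrr normr0 mulr_ge0 // ltW.
have -> : g s = a *: Dplus_iter k r (fun n =>
    d (segment (z n) (w n) s) (at_ n [:: delta]) - d (z n) (at_ n [:: delta])) 0.
  rewrite -Dplus_iterZ; apply: eq_Dplus_iter => n nr /=.
  have [Kz Kw] := Kzw _ nr; have Ks := Kc _ _ _ Kz Kw s01.
  by rewrite wz // !(jetZ (hs1 := [::]) (hs2 := [::])) // scalerBr.
rewrite normrZ ger0_norm // expr2 -mulrA ler_wpM2l //.
have /andP[s0 s1] := s01.
apply: (lipschitz_leP (delta := fun n => s *: delta n)) => //.
- by move=> n nr; have [Kz Kw] := Kzw _ nr; split => //; exact: Kc.
- move=> n nr; rewrite /segment addrC addKr.
  by rewrite wz // !scalerA mulrC.
- exact: diffs_le_segment.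
- move=> i n _ ni; rewrite Dplus_iterZ normrZ ger0_norm //.
  by rewrite (le_trans _ (Hdelta i n _ ni)) // ler_piMl.
- by move=> h; rewrite inE => /eqP ->.
Unshelve. all: by end_near. Qed.

End Bounds.
End SmoothAlongSequences.

(** * Differences and Taylor remainders of smooth curves *)

Section Curves.
Context {R : realType} {X : normedModType R}.
Implicit Types (g : nat -> R -> X) (f : R -> X).

Lemma deriv_within_shift (c d h a b s : R) f v :
  c <= a + h -> b + h <= d -> deriv_within c d f (s + h) v ->
  deriv_within a b (fun s => f (s + h)) s v.
Proof.
move=> cah bhd df e e0.
have cvs : s' + h @[s' --> s] --> s + h.
  by apply: cvgD; [exact: cvg_id|exact: cvg_cst].
have near_s := cvs _ (df _ e0).
apply: (@filterS _ (nbhs s) _ _ _ _ near_s) => s' /= H /andP[as' s'b].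
move: H; have -> : s' + h - (s + h) = s' - s by ring.
by apply; rewrite (le_trans cah) ?lerD2r //= (le_trans _ bhd) // lerD2r.
Qed.

Lemma deriv_within_sum (a b s : R) n (F : nat -> R -> X) (F' : nat -> X) :
  (forall j, deriv_within a b (F j) s (F' j)) ->
  deriv_within a b (fun s => \sum_(j < n) F j s) s (\sum_(j < n) F' j).
Proof.
move=> dF; elim: n => [|n IH].
  by under eq_fun do rewrite big_ord0; rewrite big_ord0; exact: deriv_within_cst.
under eq_fun do rewrite big_ord_recr.
by rewrite big_ord_recr /=; apply: deriv_withinD.
Qed.

Lemma deriv_within_monomial (a b s : R) n (x : X) :
  deriv_within a b (fun s => (s ^+ n.+1 / n.+1`!%:R) *: x) s
    ((s ^+ n / n`!%:R) *: x).
Proof.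
have nf0 m : (m`!%:R : R) != 0 by rewrite pnatr_eq0 -lt0n fact_gt0.
pose phi (s' : R) := (\sum_(i < n.+1) s' ^+ (n - i) * s ^+ i) / n.+1`!%:R.
have cphi : phi s' @[s' --> s] --> phi s.
  apply: cvgMr_tmp; rewrite /phi; apply: cvg_big => [|i _]; first exact: add_continuous.
  by apply: cvgMr_tmp; exact: exprn_continuous.
have phis : phi s = s ^+ n / n`!%:R.
  rewrite /phi (eq_bigr (fun=> s ^+ n)) => [|i _]; last first.
    by rewrite -exprD subnK // -ltnS.
  rewrite sumr_const card_ord -[_ *+ n.+1]mulr_natr factS natrM.
  rewrite invfM -mulrA.
  by rewrite mulVKf // pnatr_eq0.
move=> e e0.
have e1 : 0 < e / (`|x| + 1) by rewrite divr_gt0 // ltr_wpDl.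
have /cvgrPdistC_le/(_ _ e1) near_s := cphi.
apply: (@filterS _ (nbhs s) _ _ _ _ near_s) => s' H _.
have -> : (s' ^+ n.+1 / n.+1`!%:R) *: x - (s ^+ n.+1 / n.+1`!%:R) *: x =
  ((s' - s) * phi s') *: x.
  by rewrite -scalerBl -mulrBl subrXX mulrA; congr (_ * _ / _ *: _).
rewrite -phis scalerA -scalerBl -mulrBr normrZ normrM.
rewrite -mulrA mulrC ler_wpM2r //.
move: H; rewrite ler_pdivlMr ?ltr_wpDl // => H.
by apply: le_trans H; rewrite ler_wpM2l // lerDl.
Qed.

Section Bounds.
Context (T : R).
Implicit Types (k a C h : R).

Definition curve_jet n g := forall j t, (j < n)%N -> 0 <= t <= T ->
  deriv_within 0 T (g j) t (g j.+1 t).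

Lemma curve_jet_leq m n g : (m <= n)%N -> curve_jet n g -> curve_jet m g.
Proof. by move=> mn Hg j t jm; apply: Hg; exact: leq_trans mn. Qed.

Lemma curve_jetS n g : curve_jet n.+1 g -> curve_jet n (fun j => g j.+1).
Proof. by move=> Hg j t jn; apply: Hg. Qed.

(** Differences commute with translations in time, so that one of them can be
   traded for a derivative by the mean value inequality over one step. *)
Lemma Dplus_curve_le k r g a C : 0 < k -> 0 <= a -> a + r%:R * k <= T ->
  curve_jet r g -> (forall t, 0 <= t <= T -> `|g r t| <= C) ->
  `|Dplus_iter k r (fun n => g 0%N (a + n%:R * k)) 0| <= C.
Proof.
move=> k0; elim: r g a => [|r IH] g a a0 aT Hg gC.
  by apply: gC; rewrite /= mul0r addr0 a0; move: aT; rewrite mul0r addr0.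
pose f s := Dplus_iter k r (fun n => g 0%N (s + n%:R * k)) 0.
pose f' s := Dplus_iter k r (fun n => g 1%N (s + n%:R * k)) 0.
have -> : Dplus_iter k r.+1 (fun n => g 0%N (a + n%:R * k)) 0 =
    k^-1 *: (f (a + k) - f a).
  rewrite Dplus_iterSr /f -Dplus_iterB -Dplus_iterZ; apply: eq_Dplus_iter => n _.
  by rewrite /Dplus add0n -natr1 mulrDl mul1r [n%:R * k + k]addrC addrA.
rewrite normrZ gtr0_norm ?invr_gt0 // ler_pdivrMl // mulrC.
have -> : C * k = C * (a + k - a) by rewrite addrC addKr.
have akT (n : nat) s : a <= s <= a + k -> (n <= r)%N -> 0 <= s + n%:R * k <= T.
  move=> /andP[as_ sa] nr; have s0 := le_trans a0 as_.
  rewrite addr_ge0 ?mulr_ge0 ?(ltW k0) //=.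
  apply: le_trans aT; rewrite -natr1 mulrDl mul1r [_ * k + k]addrC addrA lerD //.
  by rewrite ler_wpM2r ?ler_nat // ltW.
apply: (mean_value_le (g := f')) => [|s sak|s sak].
- by rewrite lerDl ltW.
- apply: (deriv_within_Dplus_iter k (f := fun s n => g 0%N (s + n%:R * k))) => n nr.
  have aak : a <= a + k by rewrite lerDl ltW.
  have [|l0 _] := andP (akT n a _ nr); first by rewrite lexx.
  have [|_ l1] := andP (akT n (a + k) _ nr); first by rewrite lexx aak.
  by apply: (@deriv_within_shift 0 T) => //; apply: Hg => //; exact: akT.
apply: (IH (fun j => g j.+1)) => //.
- by case/andP: sak => /(le_trans a0).
- by have /andP[] := akT r s sak (leqnn r).
- exact: curve_jetS.
Qed.

(** The remainder of Taylor's formula at a later time [h] is, as a function of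
   the base point, as smooth as what is left of the curve. The induction on [q]
   rests on the fact that the derivative in [h] of the remainder for [g] is the
   remainder of the preceding order for the derivative of [g]. *)
Lemma Dplus_taylor_le k r q g a C h : 0 < k -> 0 <= a -> 0 <= h ->
  a + r%:R * k + h <= T -> curve_jet (r + q) g ->
  (forall t, 0 <= t <= T -> `|g (r + q)%N t| <= C) ->
  `|Dplus_iter k r (fun n => g 0%N (a + n%:R * k + h)
      - \sum_(j < q) (h ^+ j / j`!%:R) *: g j (a + n%:R * k)) 0| <= C * h ^+ q.
Proof.
move=> k0 a0; elim: q g h => [|q IH] g h h0 aT Hg gC.
  rewrite mulr1 (eq_Dplus_iter k (w := fun n => g 0%N (a + h + n%:R * k))).
    rewrite addn0 in Hg gC.
    by apply: Dplus_curve_le => //; [exact: addr_ge0|rewrite addrAC].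
  by move=> n _; rewrite big_ord0 subr0 addrAC.
have C0 : 0 <= C.
  apply: le_trans (gC 0 _); rewrite ?normr_ge0 // lexx.
  by apply: le_trans aT; rewrite !addr_ge0 // mulr_ge0 // ltW.
pose f s := Dplus_iter k r (fun n => g 0%N (a + n%:R * k + s)
      - \sum_(j < q.+1) (s ^+ j / j`!%:R) *: g j (a + n%:R * k)) 0.
pose f' s := Dplus_iter k r (fun n => g 1%N (a + n%:R * k + s)
      - \sum_(j < q) (s ^+ j / j`!%:R) *: g j.+1 (a + n%:R * k)) 0.
have f0 : f 0 = 0.
  rewrite /f (eq_Dplus_iter k (w := fun=> 0)) ?Dplus_iter0 // => n _.
  rewrite add0n addr0 big_ord_recl big1 => [|j _].
    by rewrite expr0 fact0 divr1 scale1r addr0 subrr.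
  by rewrite /= expr0n /= mul0r scale0r.
rewrite -/(f h) -[f h]subr0 -f0 exprSr mulrA -[X in _ <= _ * X]subr0.
apply: (mean_value_le (g := f')) => // s /andP[s0 sh].
  apply: (deriv_within_Dplus_iter k (f := fun s n => g 0%N (a + n%:R * k + s)
      - \sum_(j < q.+1) (s ^+ j / j`!%:R) *: g j (a + n%:R * k))) => n nr.
  rewrite add0n; set b := a + _.
  have b0 : 0 <= b by rewrite addr_ge0 // mulr_ge0 // ltW.
  have bT : b + h <= T.
    apply: le_trans aT; rewrite lerD2r lerD2l ler_wpM2r ?ler_nat //; exact: ltW.
  apply: deriv_withinB.
    have -> : (fun s => g 0%N (b + s)) = (fun s => g 0%N (s + b)).
      by apply/funext => t; rewrite addrC.
    rewrite [b + s]addrC; apply: (@deriv_within_shift 0 T) => //.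
    - by rewrite add0r.
    - by rewrite addrC.
    apply: Hg; first by rewrite addnS.
    by rewrite addr_ge0 //=; apply: le_trans bT; rewrite addrC lerD2l.
  have -> : (fun s => \sum_(j < q.+1) (s ^+ j / j`!%:R) *: g j b) =
      (fun s => g 0%N b + \sum_(j < q) (s ^+ j.+1 / j.+1`!%:R) *: g j.+1 b).
    by apply/funext => t; rewrite big_ord_recl expr0 divr1 scale1r.
  rewrite -[X in deriv_within _ _ _ _ X]add0r.
  apply: deriv_withinD; first exact: deriv_within_cst.
  apply: (deriv_within_sum q (F := fun j s => (s ^+ j.+1 / j.+1`!%:R) *: g j.+1 b)
    (F' := fun j => (s ^+ j / j`!%:R) *: g j.+1 b)) => j.
  exact: deriv_within_monomial.
apply: (le_trans (IH (fun j => g j.+1) s s0 _ _ _)).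
- by apply: le_trans aT; rewrite lerD2l.
- by apply: curve_jetS; rewrite -addnS.
- by move=> t tT; rewrite -addnS; exact: gC.
by rewrite ler_wpM2l // lerXn2r // nnegrE // (le_trans s0).
Qed.
End Bounds.
End Curves.

(** * Orders of magnitude of grid families and of their differences *)

Section DiffO.
Context {R : realType} (T : R).
Hypothesis T0 : 0 < T.
Implicit Types (r q i n N : nat).

Definition stepsize N : R := T / N%:R.
Local Notation k := stepsize.

(** A grid family [v], whose row [v N] lives on the grid with [N] steps, is of
   order [k ^ q] together with its differences up to order [r]. The [n]-th term
   is read for [n < N] only: stages of a method are defined on these, and not at
   the final time. *)
Definition diffO (V : normedModType R) r q (v : nat -> nat -> V) :=
  forall i, (i <= r)%N -> exists C, \forall N \near \oo, forall n, (n + i < N)%N ->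
    `|Dplus_iter (k N) i (v N) n| <= C * k N ^+ q.

Lemma stepsize_ge0 N : 0 <= k N.
Proof. by rewrite divr_ge0 // ltW. Qed.

Lemma stepsize_gt0 N : (0 < N)%N -> 0 < k N.
Proof. by move=> N0; rewrite divr_gt0 // ltr0n. Qed.

Lemma stepsize_near e : 0 < e -> \forall N \near \oo, 0 < k N <= e.
Proof.
move=> e0; exists (Num.bound (T / e)).+1 => // N /= eN.
have N0 : (0 < N)%N by exact: leq_trans eN.
rewrite stepsize_gt0 //= /stepsize ler_pdivrMr ?ltr0n // mulrC -ler_pdivrMr //.
have : T / e < (Num.bound (T / e))%:R.
  by apply: le_lt_trans (archi_boundP _) => //; rewrite divr_ge0 // ltW.
move=> /ltW /le_trans; apply; rewrite ler_nat; exact: ltnW.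
Qed.

Lemma grid_time_bounds a N n : (n < N)%N -> 0 <= a <= 1 ->
  0 <= n%:R * k N + a * k N <= T.
Proof.
move=> nN /andP[a0 a1]; have N0 : (0 < N)%N by exact: leq_ltn_trans nN.
rewrite addr_ge0 ?mulr_ge0 ?stepsize_ge0 ?(ltW T0) //=.
rewrite -mulrDl /stepsize mulrCA ger_pMr // ler_pdivrMr ?ltr0n // mul1r.
apply: (@le_trans _ _ (n.+1%:R)); last by rewrite ler_nat.
by rewrite -natr1 lerD2l.
Qed.

Lemma grid_time_bound N n : (n <= N)%N -> 0 <= n%:R * k N <= T.
Proof.
move=> nN; rewrite mulr_ge0 ?stepsize_ge0 //=.
case: N nN => [|N] nN; first by rewrite /stepsize invr0 mulr0 mulr0 ltW.
by rewrite /stepsize mulrCA ger_pMr // ler_pdivrMr ?ltr0n // mul1r ler_nat.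
Qed.

Section Closure.
Context {V : normedModType R}.
Implicit Types v w : nat -> nat -> V.

Lemma diffO_eq r q v w : (forall N n, (n < N)%N -> v N n = w N n) ->
  diffO r q v -> diffO r q w.
Proof.
move=> vw H i ir; have [C HC] := H i ir; exists C.
apply: filterS HC => N HN n ni.
rewrite -(eq_Dplus_iter (k N) (v := v N)); first exact: HN.
by move=> j ji; apply: vw; apply: leq_ltn_trans ni; rewrite leq_add2l.
Qed.

Lemma diffO_leq r r' q v : (r' <= r)%N -> diffO r q v -> diffO r' q v.
Proof. by move=> rr H i ir; apply: H; exact: leq_trans rr. Qed.

Lemma diffO_uniform r q v : diffO r q v ->
  exists2 C, 0 <= C & \forall N \near \oo, forall i n, (i <= r)%N -> (n + i < N)%N ->
    `|Dplus_iter (k N) i (v N) n| <= C * k N ^+ q.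
Proof.
elim: r => [|r IH] H.
  have [C HC] := H 0%N (leqnn _); exists `|C| => //.
  apply: filterS HC => N HN [|i] n // _ /HN /le_trans; apply.
  by rewrite ler_wpM2r ?exprn_ge0 ?stepsize_ge0 // ler_norm.
have [C C0 HC] := IH (diffO_leq (leqnSn r) H).
have [C' HC'] := H r.+1 (leqnn _).
exists (C + `|C'|); first exact: addr_ge0.
apply: filterS2 HC HC' => N HN HN' i n.
rewrite leq_eqVlt ltnS => /predU1P[-> /HN'|ir /(HN _ _ ir)] /le_trans; apply.
  by rewrite ler_wpM2r ?exprn_ge0 ?stepsize_ge0 // (le_trans (ler_norm _)) // lerDr.
by rewrite ler_wpM2r ?exprn_ge0 ?stepsize_ge0 // lerDl.
Qed.

Lemma diffOP r q v w (a : R) : diffO r q v -> diffO r q w ->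
  diffO r q (fun N n => a *: v N n + w N n).
Proof.
move=> Hv Hw i ir; have [C HC] := Hv i ir; have [C' HC'] := Hw i ir.
exists (`|a| * C + C'); apply: filterS2 HC HC' => N HN HN' n ni.
rewrite Dplus_iterP (le_trans (ler_normD _ _)) // normrZ mulrDl -mulrA.
by rewrite lerD ?HN' // ler_wpM2l // HN.
Qed.

Lemma diffOD r q v w : diffO r q v -> diffO r q w ->
  diffO r q (fun N n => v N n + w N n).
Proof.
move=> Hv Hw; apply: (diffO_eq _ (diffOP 1 Hv Hw)) => N n _; by rewrite scale1r.
Qed.

Lemma diffOB r q v w : diffO r q v -> diffO r q w ->
  diffO r q (fun N n => v N n - w N n).
Proof.
move=> Hv Hw; apply: (diffO_eq _ (diffOP (- 1) Hw Hv)) => N n _.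
by rewrite scaleN1r addrC.
Qed.

Lemma diffO0 r q : diffO r q (fun _ _ => 0 : V).
Proof.
move=> i _; exists 0; near=> N => n _.
by rewrite Dplus_iter0 normr0 mul0r.
Unshelve. all: by end_near. Qed.

Lemma diffOZ r q v (a : R) : diffO r q v -> diffO r q (fun N n => a *: v N n).
Proof.
move=> Hv; have H0 : diffO r q (fun _ _ => 0 : V) by exact: diffO0.
by apply: (diffO_eq _ (diffOP a Hv H0)) => N n _; rewrite addr0.
Qed.

Lemma diffO_step r q j v : diffO r q v ->
  diffO r (j + q) (fun N n => k N ^+ j *: v N n).
Proof.
move=> Hv i ir; have [C HC] := Hv i ir; exists C.
apply: filterS HC => N HN n ni.
rewrite Dplus_iterZ normrZ ger0_norm ?exprn_ge0 ?stepsize_ge0 // exprD mulrCA.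
by rewrite ler_wpM2l ?HN // exprn_ge0 // stepsize_ge0.
Qed.

Lemma diffO_stepV r q v : diffO r q.+1 v ->
  diffO r q (fun N n => (k N)^-1 *: v N n).
Proof.
move=> Hv i ir; have [C HC] := Hv i ir; exists C.
have := stepsize_near ltr01; apply: filterS2 HC => N HN /andP[k0 _] n ni.
rewrite Dplus_iterZ normrZ gtr0_norm ?invr_gt0 // ler_pdivrMl //.
by rewrite mulrCA -exprS HN.
Qed.

Lemma diffO_geq r q q' v : (q' <= q)%N -> diffO r q v -> diffO r q' v.
Proof.
move=> qq Hv i ir; have [C C0 HC] := diffO_uniform Hv; exists C.
have := stepsize_near ltr01; apply: filterS2 HC => N HN /andP[k0 k1] n ni.
apply: le_trans (HN _ _ ir ni) _; rewrite ler_wpM2l // -(subnK qq) exprD.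
by rewrite ler_piMl ?exprn_ge0 ?exprn_ile1 ?(ltW k0).
Qed.

Lemma diffO_integrate r q v : diffO 0 q v ->
  diffO r q (fun N => Dplus (k N) (v N)) -> diffO r.+1 q v.
Proof.
move=> Hv HD [_|i ir]; first exact: Hv.
have [C HC] := HD i ir; exists C; apply: filterS HC => N HN n ni.
by rewrite Dplus_iterSr HN // ltnW // -addnS.
Qed.

End Closure.

Section CurveO.
Context {V : normedModType R}.
Implicit Types g : nat -> R -> V.

Lemma Dplus_iter_window (v : nat -> V) h i n :
  Dplus_iter h i v n = Dplus_iter h i (fun m => v (m + n)%N) 0.
Proof. by rewrite Dplus_iter_shift. Qed.

Lemma diffO_curve r g (a : R) : 0 <= a <= 1 -> curve_jet T r g ->
  (forall j, (j <= r)%N -> exists C, forall t, 0 <= t <= T -> `|g j t| <= C) ->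
  diffO r 0 (fun N n => g 0%N (n%:R * k N + a * k N)).
Proof.
move=> a01 Hg gC i ir; have [C HC] := gC i ir; exists C.
near=> N => n ni; rewrite mulr1 Dplus_iter_window.
have N0 : (0 < N)%N by exact: leq_ltn_trans ni.
rewrite (eq_Dplus_iter (k N)
  (w := fun m => g 0%N (n%:R * k N + a * k N + m%:R * k N))).
  apply: Dplus_curve_le HC => //; first exact: stepsize_gt0.
  - by have /andP[] := grid_time_bounds (leq_ltn_trans (leq_addr i n) ni) a01.
  - by rewrite addrAC -mulrDl -natrD; have /andP[] := grid_time_bounds ni a01.
  - exact: curve_jet_leq Hg.
by move=> m _; rewrite natrD mulrDl -addrA addrC.
Unshelve. all: by end_near. Qed.

Lemma diffO_taylor r q g (a : R) : 0 <= a <= 1 -> curve_jet T (r + q) g ->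
  (forall j, (j <= r + q)%N -> exists C, forall t, 0 <= t <= T -> `|g j t| <= C) ->
  diffO r q (fun N n => g 0%N (n%:R * k N + a * k N)
    - \sum_(j < q) ((a * k N) ^+ j / j`!%:R) *: g j (n%:R * k N)).
Proof.
move=> /andP[a0 a1] Hg gC i ir.
have irq : (i + q <= r + q)%N by rewrite leq_add2r.
have [C HC] := gC _ irq; exists C.
near=> N => n ni; rewrite Dplus_iter_window.
have N0 : (0 < N)%N by exact: leq_ltn_trans ni.
have k0 := stepsize_gt0 N0.
have C0 : 0 <= C.
  by apply: le_trans (HC 0 _); rewrite ?normr_ge0 // lexx ltW.
rewrite (eq_Dplus_iter (k N) (w := fun m => g 0%N (n%:R * k N + m%:R * k N + a * k N)
    - \sum_(j < q) ((a * k N) ^+ j / j`!%:R) *: g j (n%:R * k N + m%:R * k N))).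
  apply: le_trans (Dplus_taylor_le k0 _ _ _ _ HC) _.
  - by rewrite mulr_ge0 // ltW.
  - by rewrite mulr_ge0 // ltW.
  - rewrite -mulrDl -natrD.
    by have /andP[] := grid_time_bounds ni (introT andP (conj a0 a1)).
  - exact: curve_jet_leq Hg.
  rewrite ler_wpM2l // lerXn2r ?nnegrE ?(mulr_ge0 a0 (ltW k0)) ?(ltW k0) //.
  by rewrite ler_piMl // ltW.
by move=> m _; rewrite natrD mulrDl addrC [m%:R * _ + _]addrC addrC.
Unshelve. all: by end_near. Qed.

End CurveO.
End DiffO.

(** * Smooth functions of grid families *)

Section JetO.
Context {R : realType} (T : R) {E V : normedModType R}.
Hypothesis T0 : 0 < T.
Context (D : set E) (c : R -> E) (d : E -> seq E -> V) (p : nat).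
Local Notation k := (stepsize T).
Local Notation O := (diffO T).
Implicit Types (r q i n N : nat).

(** Derivatives up to order [p] on [D], with bounds that are uniform in a tube
   around the curve [c]. *)
Definition tube_jet :=
  [/\ forall x y s, D x -> D y -> 0 <= s <= 1 -> D (segment x y s),
      forall x j, D x -> (j <= p)%N -> bounded_multilinear j (d x),
      forall x j, D x -> (j < p)%N -> forall e : R, 0 < e ->
        \forall y \near within D (nbhs x), forall hs : seq E, size hs = j ->
          `|d y hs - d x hs - d x ((y - x) :: hs)|
            <= e * `|y - x| * \prod_(h <- hs) `|h|,
      exists delta M, [/\ 0 < delta, 0 <= M &
        forall t x hs, 0 <= t <= T -> D x -> `|x - c t| <= delta ->
          (size hs <= p)%N -> `|d x hs| <= M * \prod_(h <- hs) `|h|]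
    & exists2 L, 0 <= L & forall t s, 0 <= t <= T -> 0 <= s <= T ->
        `|c t - c s| <= L * `|t - s|].

(** Closeness of order [k] to [c] at the grid points is what keeps the terms of
   a few consecutive indices in a common ball of the tube. *)
Definition grid_near r (z : nat -> nat -> E) :=
  [/\ O r 0 z, O 0 1 (fun N n => z N n - c (n%:R * k N))
    & forall N n, (n < N)%N -> D (z N n)].

Hypothesis dD : tube_jet.

Let ball_set delta t : set E := [set x | D x /\ `|x - c t| <= delta].

(** Finitely many consecutive terms of a family near the curve eventually share
   a ball of the tube, on which the bounds along sequences apply. *)
Let window r z : grid_near r z ->
  exists2 C, 0 <= C & forall delta, 0 < delta ->
    \forall N \near \oo, forall i n, (i <= r)%N -> (n + i < N)%N ->
      (forall m, (m <= i)%N -> ball_set delta (n%:R * k N) (z N (m + n)%N)) /\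
      diffs_le (k N) C 0 i (fun m => z N (m + n)%N).
Proof.
move=> [zO zc zD]; have [_ _ _ _ [L L0 Lc]] := dD.
have [C C0 HC] := diffO_uniform T0 zO; exists C => // delta delta0.
have [C' C'0 HC'] := diffO_uniform T0 zc.
have e0 : 0 < delta / (C' + L * r%:R + 1).
  by rewrite divr_gt0 // ltr_wpDl // addr_ge0 // mulr_ge0.
have := stepsize_near T0 e0.
apply: filterS3 HC HC' => N HN HN' /andP[k0 ke] i n ir ni; split; last first.
  move=> j m _ mj; rewrite Dplus_iter_shift.
  rewrite -[C]mulr1 HN //.
    by apply: leq_trans ir; rewrite (leq_trans _ mj) // leq_addl.
  by apply: leq_ltn_trans ni; rewrite addnAC [(n + i)%N]addnC leq_add2r.
move=> m mi.
have mnN : (m + n < N)%N by apply: leq_ltn_trans ni; rewrite addnC leq_add2l.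
split; first exact: zD.
rewrite -[z N _ - _](subrKA (c ((m + n)%:R * k N))).
apply: le_trans (ler_normD _ _) _.
move: ke; rewrite ler_pdivlMr; last by rewrite ltr_wpDl // addr_ge0 // mulr_ge0.
apply: le_trans; rewrite !mulrDr -[leLHS]addr0 mulr1 lerD //; last exact: ltW.
apply: lerD.
  by have := HN' 0%N (m + n)%N (leqnn _); rewrite addn0 expr1 mulrC; apply.
apply: le_trans (Lc _ _ _ _) _; try by apply: grid_time_bound => //; apply: ltnW;
  rewrite // (leq_ltn_trans _ mnN) // leq_addl.
have mk0 : 0 <= m%:R * k N by rewrite mulr_ge0 // ltW.
have -> : k N * (L * r%:R) = L * (r%:R * k N) by ring.
rewrite natrD mulrDl addrK ger0_norm // ler_wpM2l // ler_wpM2r ?(ltW k0) //.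
by rewrite ler_nat (leq_trans mi).
Qed.

Let direction r q h : O r q h ->
  exists2 C, 0 <= C & \forall N \near \oo,
    forall i n, (i <= r)%N -> (n + i < N)%N ->
      diffs_le (k N) C 0 i (fun m => (k N ^+ q)^-1 *: h N (m + n)%N : E).
Proof.
move=> hO; have [C C0 HC] := diffO_uniform T0 hO; exists C => //.
have := stepsize_near T0 ltr01; apply: filterS2 HC => N HN /andP[k0 _] i n ir ni.
move=> j m _ mj; rewrite Dplus_iterZ Dplus_iter_shift normrZ.
have kq0 : 0 < k N ^+ q by rewrite exprn_gt0.
rewrite gtr0_norm ?invr_gt0 // ler_pdivrMl // mulrC HN //.
  by apply: leq_trans ir; rewrite (leq_trans _ mj) // leq_addl.
by apply: leq_ltn_trans ni; rewrite addnAC [(n + i)%N]addnC leq_add2r.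
Qed.

Lemma ball_jet : exists delta M, [/\ 0 < delta, 0 <= M &
  forall t, 0 <= t <= T ->
    bounded_jet d p [set x | D x /\ `|x - c t| <= delta] M].
Proof.
have [Dc Dl Dd [delta [M [delta0 M0 HM]]] _] := dD.
exists delta, M; split=> // t tT; split.
- move=> x y s [Dx xt] [Dy yt] s01; split; first exact: Dc.
  have /andP[s0 s1] := s01.
  have -> : segment x y s - c t = (1 - s) *: (x - c t) + s *: (y - c t).
    rewrite segmentE !scalerBr addrACA -opprD -scalerDl subrK scale1r //.
  apply: le_trans (ler_normD _ _) _; rewrite !normrZ !ger0_norm ?subr_ge0 //.
  have -> : delta = (1 - s) * delta + s * delta by ring.
  by rewrite lerD // ler_wpM2l ?subr_ge0.
- by move=> x j [Dx _]; exact: Dl.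
- move=> x j [Dx _] jp e e0; have near_x := Dd x j Dx jp e e0.
  by apply: (@filterS _ (nbhs x) _ _ _ _ near_x) => y H [Dy _]; exact: H.
- by move=> x hs [Dx xt] sp; exact: (HM t).
Qed.

Let windows r q q' z w h h' :
  grid_near r z -> grid_near r w -> O r q h -> O r q' h' ->
  exists C M, [/\ 0 <= C, 0 <= M & \forall N \near \oo, 0 < k N /\
    forall i n, (i <= r)%N -> (n + i < N)%N -> exists K, [/\ bounded_jet d p K M,
      forall m, (m <= i)%N -> K (z N (m + n)%N) /\ K (w N (m + n)%N),
      diffs_le (k N) C 0 i (fun m => z N (m + n)%N) /\
        diffs_le (k N) C 0 i (fun m => w N (m + n)%N)
    & diffs_le (k N) C 0 i (fun m => (k N ^+ q)^-1 *: h N (m + n)%N : E) /\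
        diffs_le (k N) C 0 i (fun m => (k N ^+ q')^-1 *: h' N (m + n)%N : E)]].
Proof.
move=> zn wn hO hO'; have [delta [M [delta0 M0 HM]]] := ball_jet.
have [Cz Cz0 {}zn] := window zn; have [Cw Cw0 {}wn] := window wn.
have [Ch Ch0 {}hO] := direction hO; have [Ch' Ch'0 {}hO'] := direction hO'.
exists (Cz + Cw + Ch + Ch'), M; split=> //; first by rewrite !addr_ge0.
have le1 : Cz <= Cz + Cw + Ch + Ch' by rewrite -!addrA lerDl !addr_ge0.
have le2 : Cw <= Cz + Cw + Ch + Ch' by rewrite -!addrA addrCA lerDl !addr_ge0.
have le3 : Ch <= Cz + Cw + Ch + Ch' by rewrite addrAC lerDr !addr_ge0.
have le4 : Ch' <= Cz + Cw + Ch + Ch' by rewrite lerDr !addr_ge0.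
have {}zn := zn _ delta0; have {}wn := wn _ delta0.
apply: filterS3 (stepsize_near T0 ltr01) (filterI hO hO') (filterI zn wn).
move=> N /andP[k0 _] [{}hO {}hO'] [{}zn {}wn]; split=> // i n ir ni.
have tT : 0 <= n%:R * k N <= T.
  by apply: grid_time_bound => //; rewrite ltnW // (leq_ltn_trans _ ni) // leq_addr.
have [Kz Hz] := zn i n ir ni; have [Kw Hw] := wn i n ir ni.
exists (ball_set delta (n%:R * k N)); split; first exact: HM.
- by move=> m mi; split; [exact: Kz|exact: Kw].
- split=> j m j0 mj; first exact: le_trans (Hz j m j0 mj) le1.
  exact: le_trans (Hw j m j0 mj) le2.
- split=> j m j0 mj; first exact: le_trans (hO i n ir ni j m j0 mj) le3.
  exact: le_trans (hO' i n ir ni j m j0 mj) le4.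
Qed.

Lemma diffO_jet0 r z : (r <= p)%N -> grid_near r z ->
  O r 0 (fun N n => d (z N n) [::]).
Proof.
move=> rp zn i ir; have hO : O r 0 (fun _ _ => 0 : E) by exact: diffO0.
have [C [M [C0 M0 HW]]] := windows zn zn hO hO.
exists (chain_bound M C i 0); apply: filterS HW => N [k0 HN] n ni; rewrite mulr1.
have [K [dK Kz [Cz _] _]] := HN i n ir ni; rewrite Dplus_iter_window.
apply: (chain_leP dK k0 C0 M0 (z := fun m => z N (m + n)%N) (hs := [::])) => //.
- exact: leq_trans rp.
- by move=> m /Kz[].
- exact: diffs_leW Cz.
Qed.

(** A direction of order [k ^ q] is [k ^ q] times one with bounded differences,
   to which the bounds along sequences apply; the derivative is linear. *)
Lemma diffO_jet1 r q z h : (r < p)%N -> grid_near r z -> O r q h ->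
  O r q (fun N n => d (z N n) [:: h N n]).
Proof.
move=> rp zn hO i ir; have [C [M [C0 M0 HW]]] := windows zn zn hO hO.
exists (chain_bound M C i 1); apply: filterS HW => N [k0 HN] n ni.
have [K [dK Kz [Cz _] [Ch _]]] := HN i n ir ni; rewrite Dplus_iter_window.
have kq0 : 0 < k N ^+ q by rewrite exprn_gt0.
have ip : (1 + i <= p)%N by rewrite add1n; exact: leq_ltn_trans rp.
rewrite (eq_Dplus_iter (k N) (w := fun m => k N ^+ q *:
  d (z N (m + n)%N) [seq g m | g : nat -> E <-
     [:: fun m => (k N ^+ q)^-1 *: h N (m + n)%N]])); last first.
  move=> m mi /=; rewrite add0n -(jetZ dK (hs1 := [::]) (hs2 := [::])) //=.
  - by rewrite scalerA divff ?scale1r // gt_eqF.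
  - by have [] := Kz m mi.
  - exact: leq_ltn_trans rp.
rewrite Dplus_iterZ normrZ gtr0_norm // mulrC ler_wpM2r ?(ltW kq0) //.
apply: (chain_leP dK k0 C0 M0 (z := fun m => z N (m + n)%N)) => //.
- by move=> m /Kz[].
- exact: diffs_leW Cz.
- by move=> g; rewrite inE => /eqP ->.
Qed.

Lemma diffO_jet0B r q z w : (r < p)%N -> grid_near r z -> grid_near r w ->
  O r q (fun N n => w N n - z N n) ->
  O r q (fun N n => d (w N n) [::] - d (z N n) [::]).
Proof.
move=> rp zn wn hO i ir; have [C [M [C0 M0 HW]]] := windows zn wn hO hO.
exists (chain_bound M C i 1); apply: filterS HW => N [k0 HN] n ni.
have [K [dK Kzw [Cz Cw] [Ch _]]] := HN i n ir ni; rewrite Dplus_iter_window.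
have kq0 : 0 < k N ^+ q by rewrite exprn_gt0.
rewrite mulrC; apply: (lipschitz_leP dK k0 C0 M0 (z := fun m => z N (m + n)%N)
  (w := fun m => w N (m + n)%N) (hs := [::])) Ch _ => //.
- exact: leq_ltn_trans rp.
- exact: ltW.
- by move=> m _; rewrite scalerA divff ?scale1r // gt_eqF.
- exact: diffs_leW Cz.
- exact: diffs_leW Cw.
Qed.

Lemma diffO_jet1B r q q' z w h : (r.+1 < p)%N -> grid_near r z -> grid_near r w ->
  O r q (fun N n => w N n - z N n) -> O r q' h ->
  O r (q + q') (fun N n => d (w N n) [:: h N n] - d (z N n) [:: h N n]).
Proof.
move=> rp zn wn zwO hO i ir; have [C [M [C0 M0 HW]]] := windows zn wn zwO hO.
exists (chain_bound M C i 2); apply: filterS HW => N [k0 HN] n ni.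
have [K [dK Kzw [Cz Cw] [Czw Ch]]] := HN i n ir ni; rewrite Dplus_iter_window.
have kq0 q0 : 0 < k N ^+ q0 by rewrite exprn_gt0.
have ip : (i.+1 < p)%N by exact: leq_ltn_trans rp.
pose hs : seq (nat -> E) := [:: fun m => (k N ^+ q')^-1 *: h N (m + n)%N].
rewrite (eq_Dplus_iter (k N) (w := fun m => k N ^+ q' *:
  (d (w N (m + n)%N) [seq g m | g <- hs] - d (z N (m + n)%N) [seq g m | g <- hs])));
  last first.
  move=> m mi /=; have [Kz Kw] := Kzw m mi.
  have p0 : (0 < p)%N by exact: leq_ltn_trans ip.
  rewrite add0n scalerBr -!(jetZ dK (hs1 := [::]) (hs2 := [::])) //=.
  by rewrite scalerA divff ?scale1r // gt_eqF.
have -> : chain_bound M C i 2 * k N ^+ (q + q') =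
    k N ^+ q' * (k N ^+ q * chain_bound M C i 2) by rewrite exprD; ring.
rewrite Dplus_iterZ normrZ gtr0_norm // ler_wpM2l ?(ltW (kq0 _)) //.
apply: (lipschitz_leP dK k0 C0 M0 (z := fun m => z N (m + n)%N)
  (w := fun m => w N (m + n)%N) (hs := hs)) Czw _ => //.
- exact: ltW.
- by move=> m _; rewrite scalerA divff ?scale1r // gt_eqF.
- exact: diffs_leW Cz.
- exact: diffs_leW Cw.
- by move=> g; rewrite inE => /eqP ->.
Qed.

Lemma diffO_linearize r q z w : (r.+1 < p)%N -> grid_near r z -> grid_near r w ->
  O r q (fun N n => w N n - z N n) ->
  O r (q * 2) (fun N n => d (w N n) [::] - d (z N n) [::]
                          - d (z N n) [:: w N n - z N n]).
Proof.
move=> rp zn wn hO i ir; have [C [M [C0 M0 HW]]] := windows zn wn hO hO.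
exists (chain_bound M C i 2); apply: filterS HW => N [k0 HN] n ni.
have [K [dK Kzw [Cz Cw] [Ch _]]] := HN i n ir ni; rewrite Dplus_iter_window.
have kq0 : 0 < k N ^+ q by rewrite exprn_gt0.
rewrite mulrC exprM; apply: (linearize_le dK k0 C0 M0 (z := fun m => z N (m + n)%N)
  (w := fun m => w N (m + n)%N)) Ch => //.
- by rewrite add1n; exact: leq_ltn_trans rp.
- exact: ltW.
- by move=> m _; rewrite scalerA divff ?scale1r // gt_eqF.
- exact: diffs_leW Cz.
- exact: diffs_leW Cw.
Qed.

End JetO.

(** * Linear identities in a module *)

(** Identities between linear combinations of vectors are decided by comparing
   coefficients, which is left to [field]. *)
Section LinearExpressions.
Context {R : realType} {X : normedModType R}.

Inductive linexpr :=
  LinVar of nat | LinZero | LinAdd of linexpr & linexpr | LinOpp of linexpr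
| LinScale of R & linexpr.

Fixpoint lin_eval (x : seq X) e : X :=
  match e with
  | LinVar i => nth 0 x i
  | LinZero => 0
  | LinAdd e1 e2 => lin_eval x e1 + lin_eval x e2
  | LinOpp e1 => - lin_eval x e1
  | LinScale a e1 => a *: lin_eval x e1
  end.

Fixpoint lin_coef i e : R :=
  match e with
  | LinVar j => if eqn i j then 1 else 0
  | LinZero => 0
  | LinAdd e1 e2 => lin_coef i e1 + lin_coef i e2
  | LinOpp e1 => - lin_coef i e1
  | LinScale a e1 => a * lin_coef i e1
  end.

Lemma lin_evalE x e : lin_eval x e = \sum_(i < size x) lin_coef i e *: nth 0 x i.
Proof.
elim: e => [j||e1 IH1 e2 IH2|e IH|a e IH] /=.
- case: (ltnP j (size x)) => jx; last first.
    rewrite nth_default // big1 // => i _.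
    by rewrite -[eqn i j]/(val i == j) ltn_eqF ?scale0r // (leq_trans (ltn_ord i)).
  rewrite (bigD1 (Ordinal jx)) //= -[eqn j j]/(j == j) eqxx scale1r big1 ?addr0 //.
  by move=> i ij; rewrite -[eqn i j]/(i == Ordinal jx) (negbTE ij) scale0r.
- by rewrite big1 // => i _; rewrite scale0r.
- by rewrite IH1 IH2 -big_split; apply: eq_bigr => i _; rewrite scalerDl.
- by rewrite IH -sumrN; apply: eq_bigr => i _; rewrite scaleNr.
- by rewrite IH scaler_sumr; apply: eq_bigr => i _; rewrite scalerA.
Qed.

Fixpoint lin_eq n e1 e2 : Prop :=
  if n is n'.+1 then lin_coef n' e1 = lin_coef n' e2 /\ lin_eq n' e1 e2 else True.

Lemma lin_eval_eq x e1 e2 : lin_eq (size x) e1 e2 -> lin_eval x e1 = lin_eval x e2.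
Proof.
move=> H; rewrite !lin_evalE; apply: eq_bigr => -[i /= ix] _; congr (_ *: _).
elim: (size x) ix H => // n IH; rewrite ltnS leq_eqVlt => /predU1P[->[]//|ni [_]].
exact: IH.
Qed.

End LinearExpressions.

Ltac lin_member x l :=
  match l with
  | x :: _ => constr:(true) | _ :: ?l' => lin_member x l' | _ => constr:(false)
  end.
Ltac lin_index x l :=
  match l with
  | x :: _ => constr:(0%N) | _ :: ?l' => let n := lin_index x l' in constr:(n.+1)
  end.
Ltac lin_atoms l t :=
  lazymatch t with
  | @Algebra.add _ ?a ?b => let l1 := lin_atoms l a in lin_atoms l1 b
  | @Algebra.opp _ ?a => lin_atoms l a
  | @GRing.scale _ _ _ ?a => lin_atoms l a
  | @Algebra.zero _ => l
  | _ => lazymatch lin_member t l with true => l | false => constr:(t :: l) end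
  end.
Ltac lin_reify R l t :=
  lazymatch t with
  | @Algebra.add _ ?a ?b => let a' := lin_reify R l a in let b' := lin_reify R l b in
      constr:(@LinAdd R a' b')
  | @Algebra.opp _ ?a => let a' := lin_reify R l a in constr:(@LinOpp R a')
  | @GRing.scale _ _ ?c ?a => let a' := lin_reify R l a in constr:(@LinScale R c a')
  | @Algebra.zero _ => constr:(@LinZero R)
  | _ => let n := lin_index t l in constr:(@LinVar R n)
  end.
(** [lin R] proves an equality of vectors, up to the equations between scalars
   that remain when [field] needs a nonzero denominator. *)
Ltac lin R :=
  lazymatch goal with |- @eq ?X ?a ?b =>
    let l0 := lin_atoms (@nil X) a in let l := lin_atoms l0 b in
    let a' := lin_reify R l a in let b' := lin_reify R l b in
    change (lin_eval l a' = lin_eval l b'); apply: lin_eval_eq;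
    rewrite /=; repeat split; try by field
  end.


(** * The stages of the method *)

Section Stages.
Context {R : realType} (T : R) {X : normedModType R}.
Hypothesis T0 : 0 < T.
Local Notation k := (stepsize T).
Local Notation O := (diffO T).
Local Notation O2 := (@diffO R T (R * X)%type).
Implicit Types (r q i n N : nat) (a b : R) (v w : nat -> nat -> X).

Lemma diffO_pair r q (a : nat -> nat -> R) v :
  O r q a -> O r q v -> O2 r q (fun N n => (a N n, v N n)).
Proof.
move=> aO vO i ir; have [C HC] := aO i ir; have [C' HC'] := vO i ir.
exists (`|C| + `|C'|); apply: filterS2 HC HC' => N HN HN' n ni.
have -> : Dplus_iter (k N) i (fun n => (a N n, v N n)) n =
    (Dplus_iter (k N) i (a N) n, Dplus_iter (k N) i (v N) n).
  by rewrite /Dplus_iter; elim: i n {ir HN HN' ni} => //= i IH n; rewrite /Dplus !IH.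
rewrite prod_normE /= ge_max mulrDl.
have kq0 : 0 <= k N ^+ q by rewrite exprn_ge0 // stepsize_ge0.
apply/andP; split.
  apply: le_trans (HN n ni) _; apply: le_trans (_ : `|C| * k N ^+ q <= _).
    by rewrite ler_wpM2r // ler_norm.
  by rewrite lerDl mulr_ge0.
apply: le_trans (HN' n ni) _; apply: le_trans (_ : `|C'| * k N ^+ q <= _).
  by rewrite ler_wpM2r // ler_norm.
by rewrite lerDr mulr_ge0.
Qed.

Lemma diffO_time r a : 0 <= a <= 1 -> O r 0 (fun N n => n%:R * k N + a * k N : R).
Proof.
move=> a01.
pose g j (t : R) : R := if j is j'.+1 then (j' == 0)%:R else t.
apply: (diffO_curve T0 (g := g)) => // j.
  move=> t _ _; case: j => [|j] /= e e0; near=> s => _.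
    rewrite /GRing.scale /= mulr1 subrr normr0 mulr_ge0 //; exact: ltW.
  by rewrite subrr /GRing.scale /= mulr0 subrr normr0 mulr_ge0 // ltW.
move=> _; case: j => [|[|j]] /=.
- by exists T => t /andP[t0 tT]; rewrite ger0_norm.
- by exists 1 => t _; rewrite normr1.
- by exists 0 => t _; rewrite normr0.
Unshelve. all: by end_near. Qed.

Context (p : nat) (F : R * X -> X) (d : R * X -> seq (R * X) -> X).
Context (U : nat -> R -> X).
Let D : set (R * X) := `[0, T] `*` [set: X].
Let c (t : R) : R * X := (t, U 0%N t).

(** The problem, with all derivatives made explicit: those of [F] are [d], those
   of the solution [U 0] are the other [U j]. *)
Definition cauchy_jet :=
  [/\ tube_jet T D c d p,
      forall x, D x -> d x [::] = F x,
      curve_jet T p.+1 U,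
      forall j, (j <= p.+1)%N -> exists C, forall t, 0 <= t <= T -> `|U j t| <= C
    & forall t, 0 <= t <= T -> U 1%N t = F (t, U 0%N t)].

Hypothesis FU : cauchy_jet.

Definition dsol j a N n : X := U j (n%:R * k N + a * k N).

Definition stage a v N n : X := F (n%:R * k N + a * k N, v N n).

(** The partial derivative of [F] in space, along the solution. *)
Definition jacobian a N n (x : X) : X :=
  d (n%:R * k N + a * k N, dsol 0 a N n) [:: (0, x)].

Definition near_solution r v := O r 0 v /\ O 0 1 (fun N n => v N n - dsol 0 0 N n).

Lemma grid_domain N n a x : (n < N)%N -> 0 <= a <= 1 -> D (n%:R * k N + a * k N, x).
Proof.
by move=> nN a01; split=> //=; rewrite in_itv /=; exact: grid_time_bounds.
Qed.

Lemma dsolO r j a : (r + j <= p.+1)%N -> 0 <= a <= 1 -> O r 0 (dsol j a).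
Proof.
move=> rj a01; have [_ _ HU Ub _] := FU.
apply: (diffO_curve T0 (g := fun i => U (i + j)%N)) => //.
  move=> i t ir tT; rewrite addSn; apply: HU => //.
  by apply: leq_trans rj; rewrite ltn_add2r.
by move=> i ir; apply: Ub; apply: leq_trans rj; rewrite leq_add2r.
Qed.

Lemma near_solution_grid r a v : 0 <= a <= 1 -> near_solution r v ->
  grid_near T D c r (fun N n => (n%:R * k N + a * k N, v N n)).
Proof.
move=> a01 [vO vU]; split; first by apply: diffO_pair => //; exact: diffO_time.
  have aO : O 0 1 (fun N _ => k N ^+ 1 *: (a : R)).
    apply: (diffO_step T0 1 (q := 0) (v := fun _ _ => a)) => i.
    rewrite leqn0 => /eqP ->; exists `|a|; near=> N => n _; by rewrite mulr1.
  apply: (diffO_eq _ (diffO_pair aO vU)) => N n _.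
  rewrite /dsol mul0r addr0 expr1 /GRing.scale /=.
  by congr pair; rewrite addrAC subrr add0r mulrC.
by move=> N n nN; exact: grid_domain.
Unshelve. all: by end_near. Qed.

Lemma near_solutionD r v w b : near_solution r v -> O r 0 w ->
  near_solution r (fun N n => v N n + (b * k N) *: w N n).
Proof.
move=> [vO vU] wO; have kwO r' : (r' <= r)%N -> O r' 1 (fun N n => (b * k N) *: w N n).
  move=> rr; have := diffOZ b (diffO_step T0 1 (diffO_leq rr wO)).
  by apply: diffO_eq => N n _; rewrite scalerA expr1.
split; first exact: diffOD vO (diffO_geq T0 _ (kwO _ _)).
by apply: (diffO_eq _ (diffOD vU (kwO 0%N _))) => // N n _; rewrite addrAC.
Qed.

Lemma near_solution_perturb r v w q : (0 < q)%N -> near_solution r v ->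
  O r q (fun N n => w N n - v N n) -> near_solution r w.
Proof.
move=> q0 [vO vU] wvO; have wvO1 := diffO_geq T0 q0 wvO; split.
  apply: (diffO_eq _ (diffOD vO (diffO_geq T0 (leq0n q) wvO))) => N n _.
  by rewrite addrC subrK.
apply: (diffO_eq _ (diffOD vU (diffO_leq (leq0n r) wvO1))) => N n _.
by rewrite addrC subrKA.
Qed.

Lemma dsolB r a : (r <= p)%N -> 0 <= a <= 1 ->
  O r 1 (fun N n => dsol 0 a N n - dsol 0 0 N n).
Proof.
move=> rp a01; have [_ _ HU Ub _] := FU.
have rp1 : (r + 1 <= p.+1)%N by rewrite addn1.
have Ub1 j : (j <= r + 1)%N -> exists C, forall t, 0 <= t <= T -> `|U j t| <= C.
  by move=> jr; apply: Ub; exact: leq_trans rp1.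
apply: diffO_eq (diffO_taylor T0 (r := r) (q := 1) a01 (curve_jet_leq rp1 HU) Ub1).
move=> N n _; rewrite big_ord_recl big_ord0 expr0 fact0 divr1 scale1r addr0.
by rewrite /dsol mul0r addr0.
Qed.

Lemma dsol_near r a : (r < p.+1)%N -> 0 <= a <= 1 -> near_solution r (dsol 0 a).
Proof.
move=> rp a01; split; first by apply: dsolO => //; rewrite addn0 ltnW.
exact: dsolB.
Qed.

Lemma stageO r a v : (r <= p)%N -> 0 <= a <= 1 -> near_solution r v ->
  O r 0 (stage a v).
Proof.
move=> rp a01 vn; have [dD dF _ _ _] := FU.
have := diffO_jet0 T0 dD rp (near_solution_grid a01 vn).
by apply: diffO_eq => N n nN; rewrite dF //; exact: grid_domain.
Qed.

Lemma pair0O r q v : O r q v -> O2 r q (fun N n => (0, v N n)).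
Proof. by move=> vO; apply: diffO_pair vO; exact: diffO0. Qed.

Lemma stageB r q a v w : (r < p)%N -> 0 <= a <= 1 ->
  near_solution r v -> near_solution r w ->
  O r q (fun N n => w N n - v N n) ->
  O r q (fun N n => stage a w N n - stage a v N n).
Proof.
move=> rp a01 vn wn vwO; have [dD dF _ _ _] := FU.
have := diffO_jet0B T0 dD rp (near_solution_grid a01 vn) (near_solution_grid a01 wn).
move=> H; apply: diffO_eq (H q _) => [N n nN|].
  by rewrite !dF //; exact: grid_domain.
by apply: diffO_eq (pair0O vwO) => N n nN; congr pair; rewrite subrr.
Qed.

Lemma jacobianP N n a b x y : (n < N)%N -> (0 < p)%N -> 0 <= a <= 1 ->
  jacobian a N n (b *: x + y) = b *: jacobian a N n x + jacobian a N n y.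
Proof.
move=> nN p0 a01; have [[_ Hl _ _ _] _ _ _ _] := FU.
have [Hl1 _] := Hl _ 1%N (grid_domain (dsol 0 a N n) nN a01) p0.
rewrite -(Hl1 [::] [::] b (0, x) (0, y) erefl) /jacobian /=.
by congr (d _ [:: _]); congr pair; rewrite /= scaler0 addr0.
Qed.

Lemma jacobianO r q a v : (r < p)%N -> 0 <= a <= 1 -> O r q v ->
  O r q (fun N n => jacobian a N n (v N n)).
Proof.
move=> rp a01 vO; have [dD _ _ _ _] := FU.
apply: (diffO_jet1 T0 dD rp) (pair0O vO).
by apply: near_solution_grid => //; apply: dsol_near => //; rewrite ltnW.
Qed.

Lemma jacobianB r q a b v : (r.+1 < p)%N -> 0 <= a <= 1 -> 0 <= b <= 1 -> O r q v ->
  O r (1 + q) (fun N n => jacobian b N n (v N n) - jacobian a N n (v N n)).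
Proof.
move=> rp a01 b01 vO; have [dD _ _ _ _] := FU.
have rp' : (r < p.+1)%N by rewrite ltnW // ltnW.
apply: (diffO_jet1B T0 dD rp _ _ _ (pair0O vO)).
- exact: near_solution_grid (dsol_near rp' a01).
- exact: near_solution_grid (dsol_near rp' b01).
have tO : O r 1 (fun N n => k N ^+ 1 *: (b - a : R)).
  apply: (diffO_step T0 1 (q := 0) (v := fun _ _ => b - a)) => -[|i] _.
    by exists `|b - a|; near=> N => n _; rewrite mulr1.
  exists 0; near=> N => n _; rewrite Dplus_iterSr.
  rewrite (eq_Dplus_iter (k N) (w := fun=> 0)) ?Dplus_iter0 ?normr0 ?mul0r // => m _.
  by rewrite /Dplus subrr scaler0.
apply: (diffO_eq _ (diffO_pair tO (diffOB (dsolB rp' b01) (dsolB rp' a01)))).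
move=> N n _; rewrite expr1 /GRing.scale /=; congr pair; last by rewrite opprB subrKA.
by rewrite /=; ring.
Unshelve. all: by end_near. Qed.

(** Linearizing a stage at the solution itself, where [F] is the derivative of
   the solution. *)
Lemma stage_linearize r q a v : (r.+1 < p)%N -> 0 <= a <= 1 -> near_solution r v ->
  O r q (fun N n => v N n - dsol 0 a N n) ->
  O r (q * 2) (fun N n => stage a v N n - dsol 1 a N n
     - jacobian a N n (v N n - dsol 0 a N n)).
Proof.
move=> rp a01 vn vO; have [dD dF _ _ UF] := FU.
have rp' : (r < p.+1)%N by rewrite ltnW // ltnW.
have := diffO_linearize T0 dD rp (near_solution_grid a01 (dsol_near rp' a01))
  (near_solution_grid a01 vn).
move=> /(_ q) H; apply: diffO_eq (H _) => [N n nN|].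
  rewrite !dF; try exact: grid_domain.
  rewrite /stage /dsol UF; last exact: grid_time_bounds.
  by congr (_ - d _ [:: _]); congr pair; rewrite /= subrr.
by apply: diffO_eq (pair0O vO) => N n nN; congr pair; rewrite subrr.
Qed.

End Stages.

(** * The order of the method *)

Section Truncation.
Context {R : realType} (T : R) {X : normedModType R}.
Hypothesis T0 : 0 < T.
Local Notation k := (stepsize T).
Local Notation O := (diffO T).
Context (p : nat) (F : R * X -> X) (d : R * X -> seq (R * X) -> X).
Context (U : nat -> R -> X).
Hypothesis FU : cauchy_jet T p F d U.
Context (r : nat).
Hypothesis rp : (r + 5 <= p)%N.
Implicit Types (v w : nat -> nat -> X).
Local Notation half := (2^-1 : R).
Local Notation sol := (dsol T U).
Local Notation F_at := (stage T F).
Local Notation J := (jacobian T d U).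

(** The stages are functions of the family [v] from which the step is made, as
   they are compared for the numerical and for the exact solution. *)
Definition stage1 v := F_at 0 v.
Definition stage2 v :=
  F_at half (fun N n => v N n + (half * k N) *: stage1 v N n).
Definition stage3 v :=
  F_at half (fun N n => v N n + (half * k N) *: stage2 v N n).
Definition stage4 v := F_at 1 (fun N n => v N n + (1 * k N) *: stage3 v N n).

Definition increment v N n : X :=
  stage1 v N n + 2 *: stage2 v N n + 2 *: stage3 v N n + stage4 v N n.

Let h01 : 0 <= half <= 1. Proof. by rewrite invr_ge0 ler0n invf_le1 ?ler1n. Qed.
Let i01 : 0 <= (0 : R) <= 1. Proof. by rewrite lexx ler01. Qed.
Let j01 : 0 <= (1 : R) <= 1. Proof. by rewrite ler01 lexx. Qed.

Lemma rk4_step_increment v N n :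
  rk4_step F (k N) (n%:R * k N) (v N n) = v N n + (k N / 6) *: increment v N n.
Proof.
rewrite /rk4_step /increment /stage4 /stage3 /stage2 /stage1 /stage.
by rewrite !mul0r !addr0 !mul1r ![half * _]mulrC.
Qed.

(** Differences of order [k ^ q] between two starting families pass through the
   four stages one after the other. *)
Lemma incrementB q v w : (0 < q)%N -> near_solution T U r v ->
  O r q (fun N n => w N n - v N n) ->
  O r q (fun N n => increment w N n - increment v N n).
Proof.
move=> q0 vn wvO.
have rp0 : (r <= p)%N by lia.
have rp1 : (r < p)%N by lia.
have wn := near_solution_perturb T0 q0 vn wvO.
have next a b s : 0 <= a <= 1 ->
    near_solution T U r (s v) -> near_solution T U r (s w) ->
    O r q (fun N n => s w N n - s v N n) ->
    let s' := fun v N n => v N n + (b * k N) *: F_at a (s v) N n in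
    [/\ O r q (fun N n => F_at a (s w) N n - F_at a (s v) N n),
        near_solution T U r (s' v), near_solution T U r (s' w)
      & O r q (fun N n => s' w N n - s' v N n)].
  move=> a01 sv sw swv s'.
  have sO := stageB T0 FU rp1 a01 sv sw swv; split=> //.
  - by apply: near_solutionD => //; exact: (stageO T0 FU).
  - by apply: near_solutionD => //; exact: (stageO T0 FU).
  have ksO := diffOZ b (diffO_geq T0 (leq_addl 1 q) (diffO_step T0 1 sO)).
  apply: (diffO_eq _ (diffOD wvO ksO)) => N n _; rewrite /s'.
  lin R.
pose diff (s : (nat -> nat -> X) -> nat -> nat -> X) : Prop :=
  O r q (fun N n => s w N n - s v N n).
have [sO1 v2 w2 sO2] := next 0 half id i01 vn wn wvO.
have [sO3 v3 w3 sO4] := next half half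
  (fun v N n => v N n + (half * k N) *: stage1 v N n) h01 v2 w2 sO2.
have [sO5 v4 w4 sO6] := next half 1
  (fun v N n => v N n + (half * k N) *: stage2 v N n) h01 v3 w3 sO4.
have [sO7 _ _ _] := next 1 1
  (fun v N n => v N n + (1 * k N) *: stage3 v N n) j01 v4 w4 sO6.
have {}sO1 : diff stage1 := sO1; have {}sO3 : diff stage2 := sO3.
have {}sO5 : diff stage3 := sO5; have {}sO7 : diff stage4 := sO7.
apply: (diffO_eq _ (diffOD (diffOD sO1 (diffOZ 2 sO3)) (diffOD (diffOZ 2 sO5) sO7))).
by move=> N n _; rewrite /increment; lin R.
Qed.

Let p0 : (0 < p)%N. Proof. by move: rp; lia. Qed.
Let rp2 : (r.+1 < p)%N. Proof. by move: rp; lia. Qed.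
Let rp1 : (r < p)%N. Proof. by move: rp; lia. Qed.
Let rp0 : (r <= p)%N. Proof. by move: rp; lia. Qed.

Let taylor a j q : (r + q + j <= p.+1)%N -> 0 <= a <= 1 ->
  O r q (fun N n => sol j a N n
    - \sum_(i < q) ((a * k N) ^+ i / i`!%:R) *: sol (i + j) 0 N n).
Proof.
move=> rqj a01; have [_ _ HU Ub _] := FU.
have HUj : curve_jet T (r + q) (fun i => U (i + j)%N).
  move=> i t ir tT; rewrite addSn; apply: HU => //.
  by apply: leq_trans rqj; rewrite ltn_add2r.
have Ubj i : (i <= r + q)%N -> exists C, forall t, 0 <= t <= T -> `|U (i + j)%N t| <= C.
  by move=> ir; apply: Ub; apply: leq_trans rqj; rewrite leq_add2r.
apply: diffO_eq (diffO_taylor T0 a01 HUj Ubj) => N n _.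
by congr (_ - _); apply: eq_bigr => i _; rewrite /dsol mul0r addr0.
Qed.

Let JE a N n b x y : (n < N)%N -> 0 <= a <= 1 ->
  J a N n (b *: x + y) = b *: J a N n x + J a N n y.
Proof. by move=> nN a01; apply: (jacobianP T0 FU). Qed.

Let kO q j v : O r 0 v -> (q <= j)%N -> O r q (fun N n => k N ^+ j *: v N n).
Proof.
move=> vO qj; apply: diffO_geq (_ : (q <= j + 0)%N) _ => //; first by rewrite addn0.
exact: diffO_step.
Qed.

Let A j := sol j 0.
Let P := sol 0 half.
Let P1 := sol 1 half.
Let Q := sol 0 1.
Let Q1 := sol 1 1.
Let S1 := stage1 (A 0).
Let S2 := stage2 (A 0).
Let S3 := stage3 (A 0).
Let S4 := stage4 (A 0).
Let J2 N n := J half N n (A 2 N n).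
Let J3 N n := J half N n (A 3 N n).
Let JJ2 N n := J half N n (J2 N n).

Let S1E N n : (n < N)%N -> S1 N n = A 1 N n.
Proof.
move=> nN; have [_ _ _ _ UF] := FU.
by rewrite /S1 /stage1 /stage /A /dsol UF //; exact: grid_time_bounds.
Qed.

Let AO j : (r + j <= p.+1)%N -> O r 0 (A j).
Proof. by move=> rj; exact: (dsolO T0 FU). Qed.

Let J2O : O r 0 J2.
Proof. by apply: (jacobianO T0 FU) => //; apply: AO; lia. Qed.
Let J3O : O r 0 J3.
Proof. by apply: (jacobianO T0 FU) => //; apply: AO; lia. Qed.
Let JJ2O : O r 0 JJ2.
Proof. exact: (jacobianO T0 FU). Qed.

(** The Taylor expansions at the grid points, written as explicit linear
   combinations with their remainders. *)
Let tP N n := P N n - (A 0 N n + (k N / 2) *: A 1 N n + (k N ^+ 2 / 8) *: A 2 N n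
  + (k N ^+ 3 / 48) *: A 3 N n).
Let tQ N n := Q N n - (A 0 N n + k N *: A 1 N n + (k N ^+ 2 / 2) *: A 2 N n
  + (k N ^+ 3 / 6) *: A 3 N n).
Let tQ5 N n := Q N n - (A 0 N n + k N *: A 1 N n + (k N ^+ 2 / 2) *: A 2 N n
  + (k N ^+ 3 / 6) *: A 3 N n + (k N ^+ 4 / 24) *: A 4 N n).
Let tP1 N n := P1 N n - (A 1 N n + (k N / 2) *: A 2 N n + (k N ^+ 2 / 8) *: A 3 N n).
Let tP4 N n := P1 N n - (A 1 N n + (k N / 2) *: A 2 N n + (k N ^+ 2 / 8) *: A 3 N n
  + (k N ^+ 3 / 48) *: A 4 N n).
Let tQ4 N n := Q1 N n - (A 1 N n + k N *: A 2 N n + (k N ^+ 2 / 2) *: A 3 N n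
  + (k N ^+ 3 / 6) *: A 4 N n).

Ltac taylor_explicit :=
  move=> N n _; rewrite !big_ord_recl big_ord0 /= /bump /= ?add1n ?addn0 ?addn1
    ?factS ?fact0; lin R.

Let tPO : O r 4 tP.
Proof.
have e : (r + 4 + 0 <= p.+1)%N by move: rp; lia.
by apply: diffO_eq (taylor e h01); rewrite /tP /P /A; taylor_explicit.
Qed.
Let tQO : O r 4 tQ.
Proof.
have e : (r + 4 + 0 <= p.+1)%N by move: rp; lia.
by apply: diffO_eq (taylor e j01); rewrite /tQ /Q /A; taylor_explicit.
Qed.
Let tQ5O : O r 5 tQ5.
Proof.
have e : (r + 5 + 0 <= p.+1)%N by move: rp; lia.
by apply: diffO_eq (taylor e j01); rewrite /tQ5 /Q /A; taylor_explicit.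
Qed.
Let tP1O : O r 3 tP1.
Proof.
have e : (r + 3 + 1 <= p.+1)%N by move: rp; lia.
by apply: diffO_eq (taylor e h01); rewrite /tP1 /P1 /A; taylor_explicit.
Qed.
Let tP4O : O r 4 tP4.
Proof.
have e : (r + 4 + 1 <= p.+1)%N by move: rp; lia.
by apply: diffO_eq (taylor e h01); rewrite /tP4 /P1 /A; taylor_explicit.
Qed.
Let tQ4O : O r 4 tQ4.
Proof.
have e : (r + 4 + 1 <= p.+1)%N by move: rp; lia.
by apply: diffO_eq (taylor e j01); rewrite /tQ4 /Q1 /A; taylor_explicit.
Qed.

(** The stages at the exact solution, expanded around the slopes of the solution
   at the times of these stages: for each, first the defect [W] of its argument,
   then the remainder [B] of its value. *)
Let X2 N n := A 0 N n + (half * k N) *: S1 N n.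
Let X3 N n := A 0 N n + (half * k N) *: S2 N n.
Let X4 N n := A 0 N n + (1 * k N) *: S3 N n.

Let W2 N n := X2 N n - P N n + (k N ^+ 2 / 8) *: A 2 N n + (k N ^+ 3 / 48) *: A 3 N n.
Let B2 N n := S2 N n - P1 N n + (k N ^+ 2 / 8) *: J2 N n + (k N ^+ 3 / 48) *: J3 N n.
Let W3 N n := X3 N n - P N n - (k N ^+ 2 / 8) *: A 2 N n - (k N ^+ 3 / 24) *: A 3 N n
  + (k N ^+ 3 / 16) *: J2 N n.
Let B3 N n := S3 N n - P1 N n - (k N ^+ 2 / 8) *: J2 N n - (k N ^+ 3 / 24) *: J3 N n
  + (k N ^+ 3 / 16) *: JJ2 N n.
Let V N n := (k N ^+ 3 / 24) *: A 3 N n - (k N ^+ 3 / 8) *: J2 N n.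
Let W4 N n := X4 N n - Q N n + V N n.
Let B4 N n := S4 N n - Q1 N n + (k N ^+ 3 / 24) *: J3 N n - (k N ^+ 3 / 8) *: JJ2 N n.

Let S2E N n : F_at half X2 N n = S2 N n. Proof. by []. Qed.
Let S3E N n : F_at half X3 N n = S3 N n. Proof. by []. Qed.
Let S4E N n : F_at 1 X4 N n = S4 N n. Proof. by []. Qed.

Let nA : near_solution T U r (A 0).
Proof. by apply: (dsol_near T0 FU) => //; move: rp; lia. Qed.
Let nX2 : near_solution T U r X2.
Proof. by apply: near_solutionD => //; exact: (stageO T0 FU). Qed.
Let nX3 : near_solution T U r X3.
Proof. by apply: near_solutionD => //; exact: (stageO T0 FU). Qed.
Let nX4 : near_solution T U r X4.
Proof. by apply: near_solutionD => //; exact: (stageO T0 FU). Qed.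

Let kAO q j i : (q <= j)%N -> (i <= 5)%N -> O r q (fun N n => k N ^+ j *: A i N n).
Proof. by move=> qj i5; apply: kO => //; apply: AO; move: rp i5; lia. Qed.

Let W2O : O r 4 W2.
Proof.
apply: (diffO_eq _ (diffOZ (- 1) tPO)) => N n nN.
by rewrite /W2 /X2 S1E // /tP; lin R.
Qed.

Let B2O : O r 4 B2.
Proof.
have W2O2 : O r 2 (fun N n => X2 N n - P N n).
  have W2O' := diffO_geq T0 (isT : (2 <= 4)%N) W2O.
  apply: (diffO_eq _ (diffOB W2O' (diffOD (diffOZ 8^-1 (kAO (j := 2) (i := 2) _ _))
    (diffOZ 48^-1 (kAO (j := 3) (i := 3) _ _))))) => // N n _.
  by rewrite /W2; lin R.
have E := stage_linearize T0 FU rp2 h01 nX2 W2O2.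
apply: (diffO_eq _ (diffOD E (jacobianO T0 FU rp1 h01 W2O))) => N n nN.
have -> : X2 N n - P N n = (- (k N ^+ 2 / 8)) *: A 2 N n
    + ((- (k N ^+ 3 / 48)) *: A 3 N n + W2 N n).
  by rewrite /W2; lin R.
rewrite !JE // /B2 /J2 /J3 S2E -/(P1 N n); lin R.
Qed.

Let W3O : O r 4 W3.
Proof.
have kB := diffO_geq T0 (isT : (4 <= 1 + 4)%N) (diffO_step T0 1 B2O).
have kt := diffO_step T0 1 tP1O.
apply: (diffO_eq _ (diffOP half kB (diffOP (- 96^-1)
  (kO J3O (isT : (4 <= 4)%N)) (diffOP half kt (diffOZ (-1) tPO))))) => N n nN.
by rewrite /W3 /X3 /B2 /tP /tP1; lin R.
Qed.

Let B3O : O r 4 B3.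
Proof.
have W3O2 : O r 2 (fun N n => X3 N n - P N n).
  have W3O' := diffO_geq T0 (isT : (2 <= 4)%N) W3O.
  apply: (diffO_eq _ (diffOP 8^-1 (kAO (q := 2) (j := 2) (i := 2) _ _)
    (diffOP 24^-1 (kAO (j := 3) (i := 3) _ _)
      (diffOP (- 16^-1) (kO J2O (isT : (2 <= 3)%N)) W3O')))) => // N n _.
  by rewrite /W3; lin R.
have E := stage_linearize T0 FU rp2 h01 nX3 W3O2.
apply: (diffO_eq _ (diffOD E (jacobianO T0 FU rp1 h01 W3O))) => N n nN.
have -> : X3 N n - P N n = (k N ^+ 2 / 8) *: A 2 N n
    + ((k N ^+ 3 / 24) *: A 3 N n + ((- (k N ^+ 3 / 16)) *: J2 N n + W3 N n)).
  by rewrite /W3; lin R.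
rewrite !JE // /B3 /JJ2 -/(J2 N n) -/(J3 N n) S3E -/(P1 N n); lin R.
Qed.

Let W4O : O r 4 W4.
Proof.
have kB := diffO_geq T0 (isT : (4 <= 1 + 4)%N) (diffO_step T0 1 B3O).
have kt := diffO_step T0 1 tP1O.
apply: (diffO_eq _ (diffOD kB (diffOP 24^-1 (kO J3O (isT : (4 <= 4)%N))
  (diffOP (- 16^-1) (kO JJ2O (isT : (4 <= 4)%N)) (diffOB kt tQO))))) => N n nN.
by rewrite /W4 /X4 /V /B3 /tQ /tP1; lin R.
Qed.

Let VO : O r 3 V.
Proof.
apply: (diffO_eq _ (diffOP 24^-1 (kAO (q := 3) (j := 3) (i := 3) _ _)
  (diffOZ (- 8^-1) (kO J2O (isT : (3 <= 3)%N))))) => // N n _.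
by rewrite /V; lin R.
Qed.

Let B4O : O r 4 B4.
Proof.
have W4O2 : O r 2 (fun N n => X4 N n - Q N n).
  have W4O' := diffO_geq T0 (isT : (2 <= 4)%N) W4O.
  apply: (diffO_eq _ (diffOB W4O' (diffO_geq T0 (isT : (2 <= 3)%N) VO))) => // N n _.
  by rewrite /W4; lin R.
have E := stage_linearize T0 FU rp2 j01 nX4 W4O2.
have JV := jacobianB T0 FU rp2 h01 j01 VO.
apply: (diffO_eq _ (diffOB (diffOD E (jacobianO T0 FU rp1 j01 W4O)) JV)) => N n nN.
have -> : X4 N n - Q N n = (- 1) *: V N n + W4 N n by rewrite /W4; lin R.
have JVE : J half N n (V N n) = (k N ^+ 3 / 24) *: J3 N n - (k N ^+ 3 / 8) *: JJ2 N n.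
  have -> : V N n = (k N ^+ 3 / 24) *: A 3 N n + ((- (k N ^+ 3 / 8)) *: J2 N n + 0).
    by rewrite /V; lin R.
  have J0 : J half N n 0 = 0.
    have H : J half N n (1 *: 0 + 0) = 1 *: J half N n 0 + J half N n 0 by exact: JE.
    rewrite !scale1r addr0 in H.
    by apply: (@addrI _ (J half N n 0)); rewrite addr0 -H.
  by rewrite !JE // J0 -/(J3 N n) -/(JJ2 N n); lin R.
by rewrite JVE JE // /B4 S4E -/(Q1 N n); lin R.
Qed.

(** The weights of the method make a Simpson rule of the slopes at the three
   times, whose error has order [k ^ 4], while in
   [2 * B2 + 2 * B3 + B4] the coefficients of each of [J2], [J3] and [JJ2] add up
   to zero: these are the order conditions. *)
Lemma truncationO : O r 4 (fun N n => 6^-1 *: increment (sol 0 0) N n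
  - (k N)^-1 *: (sol 0 1 N n - sol 0 0 N n)).
Proof.
apply: (diffO_eq _ (diffOD (diffOP 3^-1 B2O (diffOP 3^-1 B3O (diffOZ 6^-1 B4O)))
  (diffOB (diffOP (2 / 3) tP4O (diffOZ 6^-1 tQ4O)) (diffO_stepV T0 tQ5O)))) => N n nN.
have k0 : k N != 0 by rewrite gt_eqF // stepsize_gt0 //; apply: leq_ltn_trans nN.
rewrite -[increment _ N n]/(S1 N n + 2 *: S2 N n + 2 *: S3 N n + S4 N n) S1E //.
rewrite -/(Q N n) -/(A 0 N n) /B2 /B3 /B4 /tP4 /tQ4 /tQ5; lin R.
Qed.

End Truncation.

(** * Uniform bounds around the solution *)

Section Uniformity.
Context {R : realType} (T : R).
Hypothesis T0 : 0 < T.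

(** Compactness of the segment, for properties that hold at all small enough
   scales [e] near each point. *)
Lemma uniform_on_segment (P : R -> R -> Prop) :
  (forall t, 0 <= t <= T -> exists2 rho, 0 < rho & forall t' e, 0 <= t' <= T ->
     `|t' - t| < rho -> 0 < e < rho -> P e t') ->
  exists2 e, 0 < e & forall t, 0 <= t <= T -> P e t.
Proof.
move=> H; have /compact_near_coveringP cov := @segment_compact R 0 T.
have {}cov := cov _ (0 : R)^'+ (fun e t => 0 <= t <= T -> P e t) _.
have : \forall e \near 0^'+, `[0, T] `<=` (fun t => 0 <= t <= T -> P e t).
  apply: cov => t /=; rewrite in_itv /= => /H [rho rho0 Hrho].
  exists (ball t rho, [set e | 0 < e < rho]) => /=.
    split; first exact: nbhsx_ballx.
    exists rho => //= e; rewrite /ball_ /= sub0r normrN => er e0.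
    by rewrite e0 /= -(gtr0_norm e0).
  move=> [t' e] /= [tt' er] t'T; apply: Hrho => //.
  by rewrite distrC.
move=> /(filterI (nbhs_right_gt 0)) /filter_ex [e [e0 He]].
by exists e => // t tT; apply: He => //=; rewrite in_itv.
Qed.

Lemma deriv_within_of_has_deriv_on (X : normedModType R) (u : R -> X) t v :
  has_deriv_on T u t v -> deriv_within 0 T u t v.
Proof.
move=> /cvgrPdist_le H e e0; have {}H := H e e0.
apply: (@filterS _ (nbhs t) _ _ _ _ H) => s /= Hs s0T.
have [->|st] := eqVneq s t.
  by rewrite !subrr scale0r subr0 !normr0 mulr0.
have st0 : s - t != 0 by rewrite subr_eq0.
have := Hs st; rewrite in_itv /= => /(_ s0T) Hv.
have -> : u s - u t - (s - t) *: v = (- (s - t)) *: (v - (s - t)^-1 *: (u s - u t)).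
  by rewrite scalerBr scalerA mulNr divff // scaleN1r opprK scaleNr addrC.
by rewrite normrZ normrN mulrC ler_wpM2r.
Qed.

Lemma deriv_within_unique (X : normedModType R) (f : R -> X) t v w :
  0 <= t <= T -> deriv_within 0 T f t v -> deriv_within 0 T f t w -> v = w.
Proof.
move=> /andP[t0 tT] fv fw; apply/eqP; rewrite -subr_eq0 -normr_le0.
apply/ler_addgt0Pr => e e0; rewrite add0r.
have e2 : 0 < e / 2 by rewrite divr_gt0.
have /nbhs_ballP[rho /= rho0 H] : nbhs t (fun s =>
    (0 <= s <= T -> `|f s - f t - (s - t) *: v| <= e / 2 * `|s - t|) /\
    (0 <= s <= T -> `|f s - f t - (s - t) *: w| <= e / 2 * `|s - t|)).
  exact: filterI (fv _ e2) (fw _ e2).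
(* small enough for one of [t + h] and [t - h] to remain in [[0, T]] *)
pose h := Num.min (rho / 2) (T / 2).
have h0 : 0 < h by rewrite lt_min !divr_gt0.
have hrho : h < rho.
  apply: le_lt_trans (_ : rho / 2 < _); first by rewrite ge_min lexx.
  by rewrite ltr_pdivrMr // ltr_pMr // ltr1n.
have hT : h <= T / 2 by rewrite ge_min lexx orbT.
have [s [s0T st]] : exists s, 0 <= s <= T /\ `|s - t| = h.
  case: (leP t (T / 2)) => tT2.
    exists (t + h); split; last by rewrite addrAC subrr add0r gtr0_norm.
    by apply/andP; split; [exact: addr_ge0 (ltW h0)|move: hT tT2; lra].
  exists (t - h); split; last by rewrite addrAC subrr add0r normrN gtr0_norm.
  by apply/andP; split; [move: hT tT2; lra|move: h0 tT; lra].
have [] := H s; first by rewrite /ball /= distrC st.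
move=> /(_ s0T) Hv /(_ s0T) Hw.
have : `|(s - t) *: (v - w)| <= e * h.
  have -> : (s - t) *: (v - w) =
     (f s - f t - (s - t) *: w) - (f s - f t - (s - t) *: v) by lin R.
  apply: le_trans (ler_normB _ _) _.
  by rewrite [e]splitr mulrDl lerD // -st.
by rewrite normrZ st mulrC ler_pM2r.
Qed.

Lemma eq_deriv_within (X : normedModType R) (f g : R -> X) t v :
  0 <= t <= T -> (forall s, 0 <= s <= T -> f s = g s) ->
  deriv_within 0 T f t v -> deriv_within 0 T g t v.
Proof.
move=> tT fg df e e0; apply: filterS (df e e0) => s H s0T.
by rewrite -!fg // H.
Qed.

Lemma curve_bounded (X : normedModType R) (f : R -> X) :
  {within `[0, T], continuous f} ->
  exists C, forall t, 0 <= t <= T -> `|f t| <= C.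
Proof.
move=> fC; have := continuous_compact fC (@segment_compact R 0 T).
move=> /compact_bounded [C [_ HC]]; exists (C + 1) => t tT.
apply: (HC (C + 1)); first by rewrite ltrDl.
by exists t => //=; rewrite in_itv.
Qed.

Context {X : normedModType R} (p : nat) (F : R * X -> X).
Context (d : R * X -> seq (R * X) -> X) (U : nat -> R -> X).
Let D : set (R * X) := `[0, T] `*` [set: X].
Let c (t : R) : R * X := (t, U 0%N t).

(** A derivative of [F] is bounded near each point of the solution by its
   continuity there; compactness gives a common radius and a common bound, both
   read off from one small parameter. *)
Lemma tube_jetP :
  (forall x j, D x -> (j <= p)%N -> bounded_multilinear j (d x)) ->
  (forall x j, D x -> (j < p)%N -> forall e : R, 0 < e ->
     \forall y \near within D (nbhs x), forall hs : seq (R * X), size hs = j ->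
          `|d y hs - d x hs - d x ((y - x) :: hs)|
            <= e * `|y - x| * \prod_(h <- hs) `|h|) ->
  (forall x j, D x -> (j <= p)%N -> forall e : R, 0 < e ->
        \forall y \near within D (nbhs x), forall hs : seq (R * X), size hs = j ->
          `|d y hs - d x hs| <= e * \prod_(h <- hs) `|h|) ->
  curve_jet T 1 U ->
  (exists C, forall t, 0 <= t <= T -> `|U 1%N t| <= C) ->
  tube_jet T D c d p.
Proof.
move=> Hl Hd Hc dU [C HC].
have cL t s : 0 <= t <= T -> 0 <= s <= T ->
    `|c t - c s| <= (1 + `|C|) * `|t - s|.
  wlog ts : t s / t <= s.
    move=> H tT sT; case: (leP t s) => [|/ltW] ts; first exact: H.
    by rewrite distrC [`|t - s|]distrC H.
  move=> tT sT.
  have UL : `|U 0%N s - U 0%N t| <= `|C| * (s - t).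
    apply: (mean_value_le (g := U 1%N)) => // x /andP[tx xs].
      have xT : 0 <= x <= T.
        move: tT sT => /andP[t0 _] /andP[_ sT].
        by rewrite (le_trans t0 tx) (le_trans xs sT).
      move=> e e0; apply: filterS (dU 0%N x isT xT e e0) => y H /andP[ty ys].
      apply: H; move: tT sT => /andP[t0 _] /andP[_ sT].
      by rewrite (le_trans t0 ty) (le_trans ys sT).
    apply: le_trans (HC x _) (ler_norm _).
    move: tT sT => /andP[t0 _] /andP[_ sT].
    by rewrite (le_trans t0 tx) (le_trans xs sT).
  rewrite prod_normE /= ge_max mulrDl mul1r lerDl mulr_ge0 //=.
  rewrite [`|t - s|]distrC ger0_norm ?subr_ge0 // distrC.
  by apply: le_trans UL _; rewrite lerDr subr_ge0.
split=> //; last by exists (1 + `|C|) => //; rewrite addr_ge0.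
- move=> [t x] [s y] a [/= tT _] [/= sT _] /andP[a0 a1].
  move: tT sT; rewrite /= !in_itv /= => /andP[t0 tT] /andP[s0 sT].
  have -> : segment (t, x) (s, y) a = (segment t s a, segment x y a) by [].
  split=> //=; rewrite in_itv /= segmentE /GRing.scale /=.
  have a1' : 0 <= 1 - a by rewrite subr_ge0.
  rewrite addr_ge0 ?mulr_ge0 //=.
  have -> : T = (1 - a) * T + a * T by ring.
  by rewrite lerD // ler_wpM2l.
pose P e t := forall x hs, D x -> `|x - c t| <= e -> (size hs <= p)%N ->
  `|d x hs| <= e^-1 * \prod_(h <- hs) `|h|.
suff [e e0 He] : exists2 e, 0 < e & forall t, 0 <= t <= T -> P e t.
  exists e, e^-1; split=> //; first by rewrite invr_ge0 ltW.
  by move=> t x hs tT Dx xt sp; exact: (He t).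
apply: uniform_on_segment => t tT.
have Dc : D (c t) by split=> //=; rewrite in_itv.
have Hq q : (q <= p)%N -> exists rho M, [/\ 0 < rho, 0 <= M &
    forall y hs, D y -> `|y - c t| < rho -> (size hs <= q)%N ->
      `|d y hs| <= M * \prod_(h <- hs) `|h|].
  elim: q => [|q IH] qp.
    have [_ [M HM]] := Hl _ _ Dc qp.
    have /nbhs_ballP[rho /= rho0 Hrho] := Hc _ _ Dc qp 1 ltr01.
    exists rho, (1 + `|M|); split; [by []|exact: addr_ge0|].
    move=> y hs Dy yc.
    rewrite leqn0 => /eqP hs0; rewrite -[d y hs](subrK (d (c t) hs)).
    rewrite mulrDl; apply: le_trans (ler_normD _ _) _; apply: lerD.
      by apply: Hrho => //; rewrite -ball_normE /ball_ /= distrC.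
    apply: le_trans (HM _ hs0) _; rewrite ler_wpM2r ?ler_norm //.
    exact: prodr_ge0.
  have [rho [M [rho0 M0 HM]]] := IH (ltnW qp).
  have [_ [M' HM']] := Hl _ _ Dc qp.
  have /nbhs_ballP[rho' /= rho'0 Hrho] := Hc _ _ Dc qp 1 ltr01.
  exists (Num.min rho rho'), (M + (1 + `|M'|)); split.
  - by rewrite lt_min rho0.
  - by rewrite !addr_ge0.
  move=> y hs Dy.
  rewrite lt_min => /andP[yc yc'].
  have P0 : 0 <= \prod_(h <- hs) `|h| by exact: prodr_ge0.
  rewrite leq_eqVlt => /predU1P[hsq|hsq]; last first.
    apply: le_trans (HM _ _ Dy yc hsq) _.
    by rewrite ler_wpM2r // lerDl addr_ge0.
  rewrite mulrDl; apply: le_trans (_ : (1 + `|M'|) * \prod_(h <- hs) `|h| <= _).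
    rewrite -[d y hs](subrK (d (c t) hs)).
    rewrite mulrDl; apply: le_trans (ler_normD _ _) _; apply: lerD.
      by apply: Hrho => //; rewrite -ball_normE /ball_ /= distrC.
    by apply: le_trans (HM' _ hsq) _; rewrite ler_wpM2r ?ler_norm.
  by rewrite lerDr mulr_ge0.
have [rho [M [rho0 M0 HM]]] := Hq p (leqnn p).
pose L := 1 + `|C|.
have L0 : 0 < L by rewrite ltr_pwDl.
exists (Num.min (rho / 2) (Num.min (rho / 2 / L) (M + 1)^-1)).
  by rewrite !lt_min invr_gt0 ltr_wpDl // !divr_gt0.
move=> t' e t'T; rewrite !lt_min => /and3P[_ t't _] /and4P[e0 er _ eM] x hs Dx xt' sp.
apply: le_trans (HM _ _ Dx _ sp) _.
  rewrite -[x - c t](subrKA (c t')) [rho]splitr.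
  apply: le_lt_trans (ler_normD _ _) _; apply: ltrD; first exact: le_lt_trans er.
  by apply: le_lt_trans (cL _ _ t'T tT) _; rewrite mulrC -ltr_pdivlMr.
rewrite ler_wpM2r ?prodr_ge0 //.
move: eM; rewrite -[e]invrK ltf_pV2 ?posrE ?invr_gt0 ?ltr_wpDl // invrK => /ltW.
by apply: le_trans; rewrite lerDl.
Qed.

End Uniformity.

(** The equation holds for [U 1] because derivatives relative to [[0, T]] are
   unique. *)
Lemma cauchy_jetP (R : realType) (T : R) (X : normedModType R) (p : nat)
    (F : R * X -> X) (u : R -> X) (u0 : X) : 0 < T ->
  Cn_on (`[0, T] `*` [set: X]) p F -> solves_cauchy T F u0 u ->
  Cn_curve T p.+1 u ->
  exists d U, cauchy_jet T p F d U /\ forall t, 0 <= t <= T -> U 0%N t = u t.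
Proof.
move=> T0 [d [dF Hl Hd Hc]] [_ uF] [U [U0 dU cU]].
have Uu t : 0 <= t <= T -> U 0%N t = u t by move=> tT; apply: U0; rewrite in_itv.
have UC j : (j <= p.+1)%N -> exists C, forall t, 0 <= t <= T -> `|U j t| <= C.
  by move=> /cU; exact: curve_bounded.
have UJ : curve_jet T p.+1 U.
  move=> j t jp tT; apply: deriv_within_of_has_deriv_on.
  by apply: dU => //; rewrite in_itv.
exists d, U; split=> //; split=> //.
  apply: tube_jetP => //; first exact: curve_jet_leq UJ.
  exact: UC.
move=> t tT; apply: (deriv_within_unique T0 tT (UJ 0%N t isT tT)).
rewrite Uu //; apply: (@eq_deriv_within _ T _ u) => //.
  by move=> s sT; rewrite Uu.
by apply: deriv_within_of_has_deriv_on; apply: uF; rewrite in_itv.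
Qed.

(** * Convergence *)

Section Convergence.
Context {R : realType} (T : R) {X : normedModType R}.
Hypothesis T0 : 0 < T.
Local Notation k := (stepsize T).
Local Notation O := (diffO T).
Context (p : nat) (F : R * X -> X) (d : R * X -> seq (R * X) -> X).
Context (U : nat -> R -> X).
Hypothesis FU : cauchy_jet T p F d U.
Hypothesis p5 : (5 <= p)%N.
Local Notation sol := (dsol T U).
Local Notation incr := (increment T F).

Lemma stage_lipschitz : exists delta M, [/\ 0 < delta, 0 <= M &
  \forall N \near \oo, forall n a v w, (n < N)%N -> 0 <= a <= 1 ->
    `|v N n - sol 0 0 N n| <= delta -> `|w N n - sol 0 0 N n| <= delta ->
    `|stage T F a v N n| <= M /\
    `|stage T F a w N n - stage T F a v N n| <= M * `|w N n - v N n| ].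
Proof.
have [dD dF _ _ _] := FU; have [delta [M [delta0 M0 HM]]] := ball_jet dD.
have p0 : (0 < p)%N by exact: leq_trans p5.
exists delta, M; split=> //.
apply: filterS (stepsize_near T0 delta0) => N /andP[k0 kd] n a v w nN a01 vU wU.
have a1 : `|a * k N| <= delta.
  case/andP: (a01) => a0 a1; rewrite ger0_norm ?(mulr_ge0 a0 (ltW k0)) //.
  by apply: le_trans kd; rewrite ler_piMl // ltW.
set t := n%:R * k N + a * k N; set t0 := n%:R * k N.
have tT : 0 <= t0 <= T by apply: grid_time_bound => //; exact: ltnW.
pose K := [set x : R * X | (`[0, T] `*` [set: X]) x /\ `|x - (t0, U 0%N t0)| <= delta].
have inK x : `|x - sol 0 0 N n| <= delta -> K (t, x).
  rewrite /dsol mul0r addr0 => xU; split; first exact: grid_domain.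
  by rewrite prod_normE /= ge_max xU andbT /t /t0 addrAC subrr add0r.
have [Kc _ _ Kb] := HM _ tT.
have Kv := inK _ vU; have Kw := inK _ wU.
have KD x : K x -> d x [::] = F x by case=> Dx _; exact: dF.
rewrite /stage -/t -!KD //; split.
  by apply: le_trans (Kb _ [::] Kv _) _; rewrite // big_nil mulr1.
rewrite -[X in _ <= X]mulr1 -[X in _ <= _ * X](subr0 1).
have := @mean_value_le R X 0 1 (fun s => d (segment (t, v N n) (t, w N n) s) [::])
  (fun s => d (segment (t, v N n) (t, w N n) s) [:: (t, w N n) - (t, v N n)])
  (M * `|w N n - v N n|) ler01.
have -> : segment (t, v N n) (t, w N n) 1 = (t, w N n).
  by rewrite segmentE subrr scale0r add0r scale1r.
have -> : segment (t, v N n) (t, w N n) 0 = (t, v N n).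
  by rewrite segmentE subr0 scale0r addr0 scale1r.
apply=> s s01.

  exact: (deriv_within_jet (HM _ tT) (hs := [::]) Kv Kw p0 s01).
apply: le_trans (Kb _ [:: _] _ _) _ => //; first exact: Kc.
rewrite big_seq1 ler_wpM2l // prod_normE /= subrr normr0.
by rewrite ge_max normr_ge0 lexx.
Qed.

(** The bounds hold in half of the tube only, as the arguments of the later
   stages differ from that of the first one by [O (k)]. *)
Lemma increment_lipschitz : exists delta L, [/\ 0 < delta, 0 <= L &
  \forall N \near \oo, forall n v w, (n < N)%N ->
    `|v N n - sol 0 0 N n| <= delta -> `|w N n - sol 0 0 N n| <= delta ->
    `|incr w N n - incr v N n| <= L * `|w N n - v N n| ].
Proof.
have [delta [M [delta0 M0 HM]]] := stage_lipschitz.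
pose L2 := M * (1 + M); pose L3 := M * (1 + L2); pose L4 := M * (1 + L3).
have L20 : 0 <= L2 by rewrite mulr_ge0 // addr_ge0.
have L30 : 0 <= L3 by rewrite mulr_ge0 // addr_ge0.
have L40 : 0 <= L4 by rewrite mulr_ge0 // addr_ge0.
exists (delta / 2), (M + 2 * L2 + 2 * L3 + L4); split; first by rewrite divr_gt0.
  by rewrite !addr_ge0 // mulr_ge0.
have e0 : 0 < Num.min 1 (delta / 2 / (M + 1)).
  by rewrite lt_min ltr01 !divr_gt0 // ltr_wpDl.
apply: filterS2 HM (stepsize_near T0 e0) => N HM /andP[k0].
rewrite le_min ler_pdivlMr ?ltr_wpDl // => /andP[k1 kM] n v w nN vU wU.
have kMd : k N * M <= delta / 2.
  by apply: le_trans kM; rewrite ler_wpM2l ?lerDl // ltW.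
have d2 : delta / 2 <= delta by rewrite ler_pdivrMr // ler_pMr // ler1n.
have next a b (s : (nat -> nat -> X) -> nat -> nat -> X) L :
    0 <= a <= 1 -> 0 <= b <= 1 ->
    `|s v N n - sol 0 0 N n| <= delta -> `|s w N n - sol 0 0 N n| <= delta ->
    `|s w N n - s v N n| <= L * `|w N n - v N n| ->
    let s' := fun v N n => v N n + (b * k N) *: stage T F a (s v) N n in
    [/\ `|s' v N n - sol 0 0 N n| <= delta, `|s' w N n - sol 0 0 N n| <= delta,
        `|stage T F a (s w) N n - stage T F a (s v) N n| <= M * L * `|w N n - v N n|
      & `|s' w N n - s' v N n| <= (1 + M * L) * `|w N n - v N n|].
  move=> a01 /andP[b0 b1] sv sw swv s'.
  have [Mv ML] := HM n a (s v) (s w) nN a01 sv sw.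
  have [Mw _] := HM n a (s w) (s v) nN a01 sw sv.
  have bk0 : 0 <= b * k N by rewrite mulr_ge0 // ltW.
  have bkk : b * k N <= k N by rewrite ler_piMl // ltW.
  have bk1 : b * k N <= 1 by exact: le_trans k1.
  have near_d x y : `|x - sol 0 0 N n| <= delta / 2 -> `|y| <= M ->
      `|x + (b * k N) *: y - sol 0 0 N n| <= delta.
    move=> xU yM; rewrite addrAC [delta]splitr.
    apply: le_trans (ler_normD _ _) _; apply: lerD => //.
    rewrite normrZ ger0_norm //; apply: le_trans kMd.
    by apply: ler_pM.
  have ML' : `|stage T F a (s w) N n - stage T F a (s v) N n| <=
      M * L * `|w N n - v N n|.
    by apply: le_trans ML _; rewrite -mulrA ler_wpM2l.
  split=> //; try exact: near_d.
  have -> : s' w N n - s' v N n = (w N n - v N n) +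
      (b * k N) *: (stage T F a (s w) N n - stage T F a (s v) N n).
    by rewrite /s'; lin R.
  apply: le_trans (ler_normD _ _) _; rewrite mulrDl mul1r lerD2l normrZ ger0_norm //.
  by apply: le_trans ML'; rewrite ler_piMl.
have h01 : 0 <= (2^-1 : R) <= 1 by rewrite invr_ge0 ler0n invf_le1 ?ler1n.
have i01 : 0 <= (0 : R) <= 1 by rewrite lexx ler01.
have j01 : 0 <= (1 : R) <= 1 by rewrite ler01 lexx.
pose diff L (s : (nat -> nat -> X) -> nat -> nat -> X) : Prop :=
  `|s w N n - s v N n| <= L * `|w N n - v N n|.
have id1 : diff 1 id by rewrite /diff mul1r.
have [v2 w2 b1 a2] := next 0 2^-1 id 1 i01 h01 (le_trans vU d2) (le_trans wU d2) id1.
rewrite mulr1 in a2.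
have [v3 w3 b2 a3] := next 2^-1 2^-1
  (fun v N n => v N n + (2^-1 * k N) *: stage1 T F v N n) _ h01 h01 v2 w2 a2.
have [v4 w4 b3 a4] := next 2^-1 1
  (fun v N n => v N n + (2^-1 * k N) *: stage2 T F v N n) _ h01 j01 v3 w3 a3.
have [_ _ b4 _] := next 1 1
  (fun v N n => v N n + (1 * k N) *: stage3 T F v N n) _ j01 j01 v4 w4 a4.
rewrite mulr1 in b1.
have {}b1 : diff M (stage1 T F) := b1. have {}b2 : diff L2 (stage2 T F) := b2.
have {}b3 : diff L3 (stage3 T F) := b3. have {}b4 : diff L4 (stage4 T F) := b4.
have -> : incr w N n - incr v N n = (stage1 T F w N n - stage1 T F v N n)
    + 2 *: (stage2 T F w N n - stage2 T F v N n)
    + 2 *: (stage3 T F w N n - stage3 T F v N n)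
    + (stage4 T F w N n - stage4 T F v N n) by rewrite /increment; lin R.
have twice L s : diff L s ->
    `|2 *: (s w N n - s v N n)| <= 2 * L * `|w N n - v N n|.
  by move=> sL; rewrite normrZ ger0_norm // -mulrA ler_wpM2l.
set e := `|w N n - v N n|.
have -> : (M + 2 * L2 + 2 * L3 + L4) * e = M * e + 2 * L2 * e + 2 * L3 * e + L4 * e.
  by ring.
apply: le_trans (ler_normD _ _) _; apply: lerD; last exact: b4.
apply: le_trans (ler_normD _ _) _; apply: lerD; last exact: twice b3.
by apply: le_trans (ler_normD _ _) _; apply: lerD; [exact: b1|exact: twice b2].
Qed.

Let rk N n : X := rk4 F (U 0%N 0) (k N) n.
Let err N n : X := rk N n - U 0%N (n%:R * k N).
Let tau N n : X := 6^-1 *: incr (sol 0 0) N n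
  - (k N)^-1 *: (sol 0 1 N n - sol 0 0 N n).

Let sol00E N n : sol 0 0 N n = U 0%N (n%:R * k N).
Proof. by rewrite /dsol mul0r addr0. Qed.

Let Dplus_err N n : (n < N)%N -> Dplus (k N) (err N) n =
  6^-1 *: (incr rk N n - incr (sol 0 0) N n) + tau N n.
Proof.
move=> nN; have k0 : k N != 0.
  by rewrite gt_eqF // stepsize_gt0 //; apply: leq_ltn_trans nN.
rewrite /Dplus /err -!sol00E.
have -> : sol 0 0 N n.+1 = sol 0 1 N n.
  by rewrite /dsol -natr1 mulrDl mul0r addr0.
have -> : rk N n.+1 = rk N n + (k N / 6) *: incr rk N n.
  by rewrite -rk4_step_increment.
by rewrite /tau; lin R.
Qed.

(** Gronwall: the bound [G n] on the error is at most [B * k ^ 4], hence below the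
   radius of the tube on fine grids, which in turn allows the next step of the
   induction. *)
Lemma rk4_error : exists2 C, 0 <= C & \forall N \near \oo, forall n, (n <= N)%N ->
  `|err N n| <= C * k N ^+ 4.
Proof.
have [delta [L [delta0 L0 HL]]] := increment_lipschitz.
have [C C0 HC] := diffO_uniform T0 (truncationO T0 FU (r := 0) p5).
pose B := T * C * expR (L * T).
have B0 : 0 <= B by rewrite !mulr_ge0 ?expR_ge0 // ltW.
exists B => //.
have e0 : 0 < Num.min 1 (delta / (B + 1)).
  by rewrite lt_min ltr01 divr_gt0 // ltr_wpDl.
apply: filterS3 HL HC (stepsize_near T0 e0) => N HL HC /andP[k0].
rewrite le_min ler_pdivlMr ?ltr_wpDl // => /andP[k1 kB].
have Bd : B * k N ^+ 4 <= delta.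
  apply: le_trans kB; rewrite mulrC; apply: ler_pM => //.
  - by rewrite exprn_ge0 // ltW.
  - by rewrite -[leRHS]expr1 ler_wiXn2l // ltW.
  - by rewrite lerDl.
pose G n := n%:R * k N * (C * k N ^+ 4) * (1 + L * k N) ^+ n.
have Ck0 : 0 <= C * k N ^+ 4 by rewrite mulr_ge0 // exprn_ge0 // ltW.
have GB n : (n <= N)%N -> G n <= B * k N ^+ 4.
  move=> nN; have /andP[nk0 nkT] := grid_time_bound T0 nN.
  have -> : B * k N ^+ 4 = T * (C * k N ^+ 4) * expR (L * T) by rewrite /B; ring.
  have Lk0 : 0 <= L * k N by rewrite mulr_ge0 // ltW.
  apply: ler_pM.
  - exact: mulr_ge0.
  - by rewrite exprn_ge0 // addr_ge0.
  - by rewrite ler_wpM2r.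
  apply: le_trans (_ : expR (L * k N) ^+ n <= _).
    by rewrite lerXn2r ?nnegrE ?addr_ge0 ?expR_ge0 // expR_ge1Dx.
  rewrite -expRM_natl ler_expR.
  have -> : n%:R * (L * k N) = L * (n%:R * k N) by ring.
  exact: ler_wpM2l.
suff H n : (n <= N)%N -> `|err N n| <= G n.
  by move=> n nN; exact: le_trans (H n nN) (GB n nN).
elim: n => [_|n IH nN].
  by rewrite /G /err /rk /= !mul0r subrr normr0.
have {}IH := IH (ltnW nN).
have -> : err N n.+1 = err N n + k N *: Dplus (k N) (err N) n.
  by rewrite /Dplus scalerA divff ?gt_eqF // scale1r addrC subrK.
rewrite Dplus_err // scalerDr addrA.
have Lk1 : 1 <= 1 + L * k N by rewrite lerDl mulr_ge0 // ltW.
apply: (@le_trans _ _ ((1 + L * k N) * `|err N n| + k N * (C * k N ^+ 4))).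
  apply: le_trans (ler_normD _ _) _; apply: lerD; last first.
    rewrite normrZ gtr0_norm // ler_wpM2l ?(ltW k0) //.
    by have := HC 0%N n isT; rewrite addn0 => /(_ nN).
  apply: le_trans (ler_normD _ _) _; rewrite mulrDl mul1r lerD2l.
  have -> : L * k N * `|err N n| = k N * (L * `|err N n|) by ring.
  rewrite normrZ (gtr0_norm k0) normrZ ler_wpM2l ?(ltW k0) //.
  rewrite ger0_norm //; apply: le_trans (_ : `|incr rk N n - incr (sol 0 0) N n| <= _).
    by rewrite ler_piMl // invf_le1 // ler1n.
  have errE : rk N n - sol 0 0 N n = err N n by rewrite sol00E.
  rewrite -errE; apply: HL => //; first by rewrite subrr normr0 ltW.
  by rewrite errE; apply: le_trans IH _; exact: le_trans (GB n (ltnW nN)) Bd.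
have Gn0 : 1 <= (1 + L * k N) ^+ n.+1 by rewrite exprn_ege1.
apply: (@le_trans _ _ ((1 + L * k N) * G n
    + k N * (C * k N ^+ 4) * (1 + L * k N) ^+ n.+1)).
  apply: lerD; first by rewrite ler_wpM2l // (le_trans ler01).
  by rewrite ler_peMr // mulr_ge0 // ltW.
by rewrite /G -(natr1 n) [_ ^+ n.+1]exprS le_eqVlt; apply/orP; left; apply/eqP; ring.
Qed.

(** In the error equation the error enters through a Lipschitz function of grid
   families: its order is passed on to its differences. *)
Let Dplus_errO_of r : (r + 5 <= p)%N -> O r 4 err ->
  O r 4 (fun N => Dplus (k N) (err N)).
Proof.
move=> rp eO; have rp0 : (r < p.+1)%N by lia.
have solN : near_solution T U r (sol 0 0).
  by apply: (dsol_near T0 FU) => //; rewrite lexx ler01.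
have eO' : O r 4 (fun N n => rk N n - sol 0 0 N n).
  by apply: diffO_eq eO => N n _; rewrite sol00E.
have iO := incrementB T0 FU rp (isT : (0 < 4)%N) solN eO'.
apply: (diffO_eq _ (diffOP 6^-1 iO (truncationO T0 FU rp))) => N n nN.
by rewrite Dplus_err.
Qed.

Let errO r : (r + 4 <= p)%N -> O r 4 err.
Proof.
elim: r => [_|r IH rp].
  move=> i; rewrite leqn0 => /eqP ->; have [C C0 HC] := rk4_error.
  by exists C; apply: filterS HC => N HN n; rewrite addn0 => nN; apply: HN; exact: ltnW.
apply: diffO_integrate.
  move=> i; rewrite leqn0 => /eqP ->; have [C C0 HC] := rk4_error.
  by exists C; apply: filterS HC => N HN n; rewrite addn0 => nN; apply: HN; exact: ltnW.
by apply: Dplus_errO_of; [lia|apply: IH; lia].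
Qed.

(** The last term [n + m = N] is reached although [diffO] reads only the terms
   before the final time: for [m > 0] these are differences of [Dplus err], whose
   terms are indexed by the steps, and the case [m = 0] is [rk4_error]. *)
Lemma Dplus_errorO : exists2 C, 0 <= C & \forall N \near \oo,
  forall m n, (m <= p - 4)%N -> (n + m <= N)%N ->
    `|Dplus_iter (k N) m (err N) n| <= C * k N ^+ 4.
Proof.
have [C C0 HC] := rk4_error.
have [C' C'0 HC'] : exists2 C, 0 <= C & \forall N \near \oo, forall i n,
    (i <= p - 5)%N -> (n + i < N)%N ->
    `|Dplus_iter (k N) i (Dplus (k N) (err N)) n| <= C * k N ^+ 4.
  by apply: (diffO_uniform T0); apply: Dplus_errO_of; [|apply: errO]; lia.
exists (C + C'); first exact: addr_ge0.
apply: filterS2 HC HC' => N HN HN' [|m] n mp nm.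
  rewrite addn0 in nm; apply: le_trans (HN n nm) _.
  by rewrite ler_wpM2r ?exprn_ge0 ?stepsize_ge0 // lerDl.
rewrite Dplus_iterSr; apply: le_trans (HN' m n _ _) _; [lia|lia|].
by rewrite ler_wpM2r ?exprn_ge0 ?stepsize_ge0 // lerDr.
Qed.

End Convergence.

Lemma bounded_on_cube (R : realType) (g : nat -> nat -> nat -> R) K :
  exists C, forall a b c, (a < K)%N -> (b < K)%N -> (c < K)%N -> g a b c <= C.
Proof.
exists (\sum_(x : 'I_K * 'I_K * 'I_K) `|g x.1.1 x.1.2 x.2|) => a b c aK bK cK.
rewrite (bigD1 (Ordinal aK, Ordinal bK, Ordinal cK)) //=.
by apply: le_trans (ler_norm _) _; rewrite lerDl sumr_ge0.
Qed.

Theorem theorem1 (R : realType) (X : completeNormedModType R) (T : R)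
    (hT : 0 < T) (u0 : X) (p : nat) (hp : (6 <= p)%N) (F : R * X -> X)
    (hF : Cn_on (`[0, T] `*` [set: X]) p F)
    (u : R -> X) (hu : unique_solution T F u0 u) (huC : Cn_curve T p.+1 u) :
  exists C : R, forall N : nat, (0 < N)%N ->
    let k := T / N%:R in
    forall m n : nat, (m <= p - 4)%N -> (n + m <= N)%N ->
      `|Dplus_iter k m (fun i => rk4 F u0 k i - u (i%:R * k)) n| <= C * k ^+ 4.
Proof.
have [d [U [FU Uu]]] := cauchy_jetP hT hF (proj1 hu) huC.
have p5 : (5 <= p)%N by exact: leq_trans hp.
have U00 : U 0%N 0 = u0 by rewrite Uu ?lexx ?ltW //; case: hu => -[].
have [C C0 [N0 _ HC]] := Dplus_errorO hT FU p5.
have [C' HC'] := bounded_on_cube (fun N m n => `|Dplus_iter (T / N%:R) m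
  (fun i => rk4 F u0 (T / N%:R) i - u (i%:R * (T / N%:R))) n| / (T / N%:R) ^+ 4) N0.+1.
(* [C] serves the fine grids, [C'] the finitely many coarse ones *)
exists (C + `|C'|) => N Npos k m n mp nmN.
have k0 : 0 < k by rewrite divr_gt0 // ltr0n.
have k40 : 0 < k ^+ 4 by rewrite exprn_gt0.
case: (leqP N0 N) => [NN|NN]; last first.
  rewrite -ler_pdivrMr //; apply: le_trans (HC' N m n _ _ _) _; try lia.
  by apply: le_trans (ler_norm _) _; rewrite lerDr.
rewrite (eq_Dplus_iter k (w := fun i => rk4 F (U 0%N 0) k i - U 0%N (i%:R * k))).
  apply: le_trans (HC N NN m n mp nmN) _.
  by rewrite ler_wpM2r ?(ltW k40) // lerDl.
move=> i im; rewrite U00 Uu //; apply: grid_time_bound => //.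
by apply: leq_trans nmN; rewrite leq_add2l.
Qed.
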